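(* There is a universal constant $C>0$ such that the following holds. For every pair of integers $1\le k<n$, let $P$ be the transition kernel of the $k$-column walk on $\mathrm{St}(n,k)$, let $D$ be the Riemannian distance on $\mathrm{St}(n,k)$, and let $W_D$ be the Wasserstein distance with cost $D$. Then, for every integer $T\ge 0$ and every pair of starting points $X_0,Y_0\in \mathrm{St}(n,k)$, $$W_D\left(P^T(X_0,\cdot),P^T(Y_0,\cdot)\right)\le n^{-\left\lfloor T/\left(Cn(k+\log n)\log n\right)\right\rfloor}\,D(X_0,Y_0).$$
   Context: $\mathrm{St}(n,k)=\{X\in\mathbb{R}^{n\times k}: X^\top X=I_k\}$ is the Stiefel manifold; $D$ is the Riemannian (geodesic) distance on it induced by the embedding in $\mathbb{R}^{n\times k}$ with the Frobenius inner product. For $1\le i<j\le n$ and $\theta\in[0,2\pi)$ let $R_{ij}(\theta)=I_n+(\cos\theta-1)(E_{ii}+E_{jj})+\sin\theta\,E_{ij}-\sin\theta\,E_{ji}$, where $E_{ab}$ are the $n\times n$ matrix units. The $k$-column walk is the Markov chain on $\mathrm{St}(n,k)$ given by $X_{t+1}=R_{i_tj_t}(\theta_t)X_t$, where the pairs $(i_t,j_t)$ are i.i.d. uniform on $\{(i,j):1\le i<j\le n\}$ and the $\theta_t$ are i.i.d. uniform on $[0,2\pi)$, independent of the pairs. $P^T(X,\cdot)$ is the law after $T$ steps started from $X$. For probability measures $\mu,\nu$, $W_D(\mu,\nu)=\inf \mathbb{E}[D(U,V)]$ over couplings $(U,V)$ of $\mu$ and $\nu$. *)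

(* Defs.v *)
From HB Require Import structures.
From mathcomp Require Import all_boot all_order all_algebra.
From mathcomp Require Import all_classical all_reals all_analysis.
From mathcomp Require Import measurable_realfun.
From mathcomp Require Import ring.

Set Implicit Arguments.
Unset Strict Implicit.
Unset Printing Implicit Defensive.

Import Order.TTheory GRing.Theory Num.Theory.
Import numFieldNormedType.Exports.

Local Open Scope classical_set_scope.
Local Open Scope ring_scope.

(* Matrices carry the Borel sigma-algebra of their (product) topology. *)
Section borel_matrix.
Context (R : realType) (n k : nat).
Local Notation M := 'M[R]_(n, k).

HB.instance Definition _ := @isMeasurable.Build (sigma_display (@open M)) M
  <<s @open M >> (@sigma_algebra0 _ setT _) (@sigma_algebraC _ _)
  (@sigma_algebra_bigcup _ setT _).

Lemma open_measurable_mx (A : set M) : open A -> measurable A.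
Proof. exact: sub_sigma_algebra. Qed.

Lemma measurable_coord (i : 'I_n) (j : 'I_k) :
  measurable_fun [set: M] (fun A : M => A i j).
Proof.
apply: (measurability _ (RGenOpens.measurableE R)) => _ [_ [a [b ->]] <-].
rewrite setTI; apply: open_measurable_mx.
apply: open_comp; last exact: interval_open.
by move=> A _; exact: coord_continuous.
Qed.

Lemma open_rat_balls (U : set M) : open U ->
  U = \bigcup_(qm in [set qm : 'M[rat]_(n, k) * nat |
                       ball (map_mx ratr qm.1 : M) qm.2.+1%:R^-1 `<=` U])
        ball (map_mx ratr qm.1 : M) qm.2.+1%:R^-1.
Proof.
move=> oU; apply/seteqP; split=> [A UA|A [qm /= qmU]]; last exact: qmU.
have /nbhs_ballP[e /= e0 AeU] : nbhs A U by exact: open_nbhs_nbhs.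
have [m me] : exists m, (m.+1%:R^-1 : R) < e / 2.
  have e20 : 0 < e / 2 by rewrite divr_gt0.
  have [m _ /(_ m (leqnn m)) me] := near_infty_natSinv_lt (PosNum e20).
  by exists m.
have [q Aq] : exists q : 'M[rat]_(n, k),
    forall i j, `|A i j - ratr (q i j)| < m.+1%:R^-1.
  have h i j : exists r : rat, `|A i j - ratr r| < m.+1%:R^-1.
    have /rat_in_itvoo[r] : A i j - m.+1%:R^-1 < A i j + m.+1%:R^-1.
      by rewrite ltrBlDr -addrA ltrDl addr_gt0// invr_gt0.
    by rewrite in_itv/= -ltr_distlC => ?; exists r.
  exists (\matrix_(i, j) projT1 (cid (h i j))) => i j.
  by rewrite mxE; case: cid.
have m0 : 0 < (m.+1%:R^-1 : R) by rewrite invr_gt0.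
have qA : ball (map_mx ratr q : M) m.+1%:R^-1 A.
  by split=> // i j; rewrite mxE /ball/= distrC.
exists (q, m) => /= [B qB|]; last exact: qA.
apply: AeU; split=> // i j; rewrite /ball/=.
have := ler_distD (ratr (q i j)) (A i j) (B i j).
move=> /le_lt_trans; apply; rewrite [e in _ < e]splitr; apply: ltrD.
  exact: lt_trans (Aq i j) me.
have [_ /(_ i j)] := qB; rewrite mxE /ball/= => qBij.
exact: lt_trans qBij me.
Qed.

(* For a map into matrices, Borel measurability is entrywise measurability. *)
Lemma measurable_fun_mx d (T : measurableType d) (f : T -> M) :
  (forall i j, measurable_fun [set: T] (fun x => f x i j)) ->
  measurable_fun [set: T] f.
Proof.
move=> mf; apply: (@measurability _ _ _ _ _ _ (@open M)) => // _ [U oU <-].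
rewrite setTI (open_rat_balls oU) bigcup_mkcond preimage_bigcup.
apply: countable_bigcupT_measurable => // -[q m].
case: ifPn => _; last by rewrite preimage_set0.
rewrite (_ : _ @^-1` _ = \bigcap_(ij in [set: 'I_n * 'I_k])
    (fun x => f x ij.1 ij.2) @^-1` ball (map_mx ratr q ij.1 ij.2 : R) m.+1%:R^-1).
  apply: fin_bigcap_measurable => // ij _; rewrite -[X in measurable X]setTI.
  by apply: mf => //; exact: measurable_ball.
apply/seteqP; split=> [x [_ qfx] [i j] _|x qfx]; first exact: qfx.
by split=> [|i j]; [rewrite invr_gt0|exact: (qfx (i, j))].
Qed.

End borel_matrix.

Section riemannian_distance.
Context (R : realType) (n k : nat).
Local Notation M := 'M[R]_(n, k).

Definition stiefel : set M := [set X | X^T *m X = 1%:M].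

Definition frobenius_norm (A : M) : R :=
  Num.sqrt (\sum_(i < n) \sum_(j < k) A i j ^+ 2).

(* On each closed piece [a, b] the derivative of gamma, taken on ]a, b[, extends
   continuously to [a, b]; as gamma is continuous, this says that gamma is C^1
   on [a, b] with one-sided derivatives at a and b. *)
Definition piecewise_C1 (gamma : R -> M) : Prop :=
  {within `[0, 1], continuous gamma} /\
  exists2 s : seq R, itv_partition 0 1 s & forall m, (m < size s)%N ->
    let a := nth 1 (0 :: s) m in
    let b := nth 1 (0 :: s) m.+1 in
    {in `]a, b[, forall t, derivable gamma t 1} /\
    exists2 dgamma : R -> M, {within `[a, b], continuous dgamma} &
      {in `]a, b[, derive1 gamma =1 dgamma}.

(* At the finitely many break points derive1 gamma may be a default value, which
   does not affect the integral. *)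
Definition curve_length (gamma : R -> M) : \bar R :=
  (\int[lebesgue_measure]_(t in `[0%R, 1%R])
    (frobenius_norm (derive1 gamma t))%:E)%E.

(* Infimum of the lengths of curves inside the Stiefel manifold; it is +oo when
   there is no such curve, in particular off the manifold. *)
Definition stiefel_dist (X Y : M) : \bar R :=
  ereal_inf [set curve_length gamma | gamma in
    [set gamma | [/\ piecewise_C1 gamma, gamma 0 = X, gamma 1 = Y &
                  {in `[0, 1], forall t, stiefel (gamma t)}]]].

End riemannian_distance.

Section wasserstein.
Context d (T : measurableType d) (R : realType).
Implicit Types mu nu : set T -> \bar R.

Definition coupling mu nu (Q : probability (T * T)%type R) : Prop :=
  forall A, measurable A ->
    Q (fst @^-1` A) = mu A /\ Q (snd @^-1` A) = nu A.

Definition wasserstein (D : T -> T -> \bar R) mu nu : \bar R :=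
  ereal_inf [set (\int[Q]_z D z.1 z.2)%E | Q in coupling mu nu].

End wasserstein.

Lemma card_pairs n : #|[pred p : 'I_n * 'I_n | (p.1 < p.2)%N]| = 'C(n, 2).
Proof.
rewrite -bin2_sum -sum1_card big_mkord.
rewrite -(pair_big_dep predT (fun i j : 'I_n => (i < j)%N) (fun _ _ => 1%N))/=.
rewrite (exchange_big_dep predT)//=; apply: eq_bigr => j _.
rewrite -(big_ord_widen n (fun=> 1%N)) ?(ltnW (ltn_ord j))//.
by rewrite sum1_card card_ord.
Qed.

Section walk.
Context (R : realType) (n k : nat).
Local Notation M := 'M[R]_(n, k).
Implicit Types (X : M) (p : 'I_n * 'I_n) (theta : R) (A : set M).

Definition rotation (i j : 'I_n) theta : 'M[R]_n :=
  1%:M + (cos theta - 1) *: (delta_mx i i + delta_mx j j)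
  + sin theta *: delta_mx i j - sin theta *: delta_mx j i.

Lemma rotation_orthogonal (i j : 'I_n) theta : i != j ->
  (rotation i j theta)^T *m rotation i j theta = 1%:M.
Proof.
move=> ij; pose E := delta_mx i i + delta_mx j j : 'M[R]_n.
pose J := delta_mx i j - delta_mx j i : 'M[R]_n.
pose c := cos theta - 1; pose s := sin theta.
have -> : rotation i j theta = 1%:M + c *: E + s *: J.
  by rewrite /rotation scalerBr addrA.
have -> : (1%:M + c *: E + s *: J)^T = 1%:M + c *: E - s *: J.
  apply/matrixP => a b; rewrite !mxE (eq_sym b a) ![(b == _) && _]andbC.
  ring.
have EE : E *m E = E.
  rewrite /E mulmxDl !mulmxDr !mul_delta_mx !mul_delta_mx_0 ?addr0 ?add0r//.
  by rewrite eq_sym.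
have EJ : E *m J = J.
  rewrite /E /J mulmxDl !mulmxBr !mul_delta_mx !mul_delta_mx_0 ?subr0 ?sub0r//.
  by rewrite eq_sym.
have JE : J *m E = J.
  rewrite /E /J mulmxBl !mulmxDr !mul_delta_mx !mul_delta_mx_0 ?addr0 ?add0r//.
  by rewrite eq_sym.
have JJ : J *m J = - E.
  rewrite /E /J mulmxBl !mulmxBr !mul_delta_mx !mul_delta_mx_0 ?subr0 ?sub0r//.
    by rewrite opprD.
  by rewrite eq_sym.
have cs : c * c + s * s = - c - c.
  by rewrite -!expr2 /c /s sin2cos2; ring.
rewrite !mulmxDr !mulmxDl !mulNmx !mul1mx !mulmx1 -!scalemxAl -!scalemxAr.
rewrite EE EJ JE JJ !scalerA !scalerN opprK.
have ss : s * s = - c - c - c * c by rewrite -cs addrC addKr.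
rewrite ss (mulrC s c); apply/matrixP => a b; rewrite !mxE; ring.
Qed.

(* The kernels below live on all matrices; by this lemma they restrict to the
   Stiefel manifold. *)
Lemma stiefel_rotation (i j : 'I_n) theta X : i != j ->
  stiefel X -> stiefel (rotation i j theta *m X).
Proof.
move=> ij; rewrite /stiefel/= => XX.
by rewrite trmx_mul mulmxA -(mulmxA X^T) rotation_orthogonal// mulmx1.
Qed.

Lemma twopi_gt0 : 0 < 2 * pi :> R.
Proof. by rewrite mulr_gt0// pi_gt0. Qed.

(* Law of R_ij(theta) X for theta uniform, where p = (i, j). The library puts
   the uniform law on [0, 2 pi] instead of [0, 2 pi[; as it charges no point,
   this is the same law. *)
Definition rotation_law p X : set M -> \bar R :=
  pushforward (uniform_prob twopi_gt0)
    (fun theta => rotation p.1 p.2 theta *m X).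

Definition walk_step X A : \bar R :=
  (('C(n, 2)%:R^-1)%:E *
     \sum_(p : 'I_n * 'I_n | (p.1 < p.2)%N) rotation_law p X A)%E.

Lemma measurable_rotation_mul p :
  measurable_fun [set: M * R] (fun z => rotation p.1 p.2 z.2 *m z.1).
Proof.
apply: measurable_fun_mx => i j; under eq_fun do rewrite mxE.
apply: measurable_sum => l; apply: measurable_funM; last first.
  exact: (measurableT_comp (measurable_coord l j)).
apply: (measurableT_comp (f := fun t => rotation p.1 p.2 t i l)) => //.
under eq_fun do rewrite !mxE.
have mcos : measurable_fun [set: R] (@cos R).
  by apply: continuous_measurable_fun; exact: continuous_cos.
have msin : measurable_fun [set: R] (@sin R).
  by apply: continuous_measurable_fun; exact: continuous_sin.
apply: measurable_funB; last exact: measurable_funM.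
apply: measurable_funD; last exact: measurable_funM.
apply: measurable_funD => //.
by apply: measurable_funM => //; exact: measurable_funB.
Qed.

Lemma measurable_rotation p X :
  measurable_fun [set: R] (fun theta => rotation p.1 p.2 theta *m X).
Proof.
exact: (measurableT_comp (measurable_rotation_mul p) (pair1_measurable X)).
Qed.

Let walk_step0 X : walk_step X set0 = 0%E.
Proof.
rewrite /walk_step big1 ?mule0// => p _.
by rewrite /rotation_law /pushforward preimage_set0 measure0.
Qed.

Let rotation_law_ge0 p X A : (0 <= rotation_law p X A)%E.
Proof. exact: (measure_ge0 (uniform_prob twopi_gt0)). Qed.

Let walk_step_ge0 X A : (0 <= walk_step X A)%E.
Proof. by rewrite mule_ge0 ?lee_fin// sume_ge0. Qed.

Let walk_step_sigma_additive X : semi_sigma_additive (walk_step X).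
Proof.
move=> F mF tF mUF.
rewrite [X in X @ _](_ : _ = fun m => (('C(n, 2)%:R^-1)%:E *
    \sum_(p : 'I_n * 'I_n | (p.1 < p.2)%N)
      \sum_(0 <= i < m) rotation_law p X (F i))%E); last first.
  apply/funext => m; rewrite exchange_big/= ge0_sume_distrr// => i _.
  exact: sume_ge0.
apply: cvgeZl => //; apply: cvg_nnesum => p _.
  by apply: nearW => m; exact: sume_ge0.
rewrite /rotation_law /pushforward preimage_bigcup.
apply: measure_semi_sigma_additive.
- by move=> i; rewrite -[X in measurable X]setTI; exact: measurable_rotation.
- apply/trivIsetP => i j _ _ ij; rewrite -preimage_setI.
  by move/trivIsetP : tF => /(_ i j I I ij) ->; rewrite preimage_set0.
- rewrite -preimage_bigcup -[X in measurable X]setTI.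
  exact: measurable_rotation.
Qed.

HB.instance Definition _ X := isMeasure.Build _ _ _ (walk_step X)
  (walk_step0 X) (walk_step_ge0 X) (@walk_step_sigma_additive X).

Definition walk_kernel : M -> {measure set M -> \bar R} := walk_step.

Let measurable_walk_kernel A : measurable A ->
  measurable_fun [set: M] (walk_kernel ^~ A).
Proof.
move=> mA; rewrite (_ : walk_kernel ^~ A = fun X => (('C(n, 2)%:R^-1)%:E *
    \sum_(p : 'I_n * 'I_n)
      if (p.1 < p.2)%N then rotation_law p X A else 0)%E); last first.
  by apply/funext => X; rewrite /walk_kernel/= /walk_step big_mkcond.
apply: measurable_funeM.
apply: emeasurable_sum => p; case: (p.1 < p.2)%N => //.
have := measurable_fun_xsection (uniform_prob twopi_gt0)
  (measurable_rotation_mul p measurableT mA).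
by apply: eq_measurable_fun => X _ /=; rewrite setTI xsectionE.
Qed.

HB.instance Definition _ :=
  isKernel.Build _ _ _ _ R walk_kernel measurable_walk_kernel.

Let walk_kernelT X : walk_kernel X [set: M] = ('C(n, 2)%:R^-1 * 'C(n, 2)%:R)%:E.
Proof.
rewrite /walk_kernel/= /walk_step (eq_bigr (fun=> 1%E)).
  by rewrite sumEFin sumr_const card_pairs EFinM.
by move=> p _; rewrite /rotation_law /pushforward preimage_setT probability_setT.
Qed.

Let walk_kernel_sub :
  (ereal_sup [set walk_kernel X [set: M] | X in [set: M]] <= 1)%E.
Proof.
apply/(sprob_kernelP walk_kernel) => X; rewrite walk_kernelT lee_fin.
by have [->|c0] := eqVneq ('C(n, 2)%:R : R) 0; rewrite ?mulr0// mulVf.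
Qed.

HB.instance Definition _ :=
  Kernel_isSubProbability.Build _ _ _ _ R walk_kernel walk_kernel_sub.

(* The T-th power of the kernel. For n < 2 there is no pair (i, j) and walk_kernel
   is zero, hence only a subprobability kernel; it is a probability kernel as soon
   as 1 < n, see walk_kernel_prob. *)
Fixpoint walk_iter (T : nat) : R.-spker M ~> M :=
  if T is T'.+1 then mkcomp_noparam (walk_iter T') walk_kernel
  else kdirac (@measurable_id _ M setT).

Lemma walk_kernel_prob X : (1 < n)%N -> walk_kernel X [set: M] = 1%E.
Proof.
by move=> n1; rewrite walk_kernelT mulVf// pnatr_eq0 -lt0n bin_gt0.
Qed.

End walk.

Arguments walk_iter {R n k} T.

(* Main.v *)
(** Move a whole curve [gamma] joining [X0] to [Y0] with one and the same noise:
    at each step the point of parameter [t] is rotated by [R_ij (theta + h t)],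
    where the angle [h t] is the primitive of an angular velocity [sigma t]
    depending on the past only. As [theta] is uniform on the circle, every point
    of the curve performs the walk, so that the end points of the random curve
    are a coupling of the two laws, and its length bounds their distance. If
    [(X, V)] is the position and the velocity at [t], the new velocity is
    [R_ij (theta + h t) (V + sigma t J_ij X)] with [J_ij = E_ij - E_ji].

    The choice [sigma = - A_ij / (a_i + a_j + d)], with [A_ij = <V, J_ij X>],
    [a_i = |x_i|^2] and [d] of order [k / n], never increases [|V|^2] and lowers
    it by at least [A_ij^2 / (a_i + a_j + d)], where the [A_ij^2] sum up to at
    least [|V|^2]. The heavy rows, which spoil this gain, are controlled by a
    Lyapunov function
    [|V|^2 + g (\sum_i a_i |v_i|^2 + \sum_i a_i |V x_i|^2) + z |V|^2 \sum_i a_i^2]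
    with [g] of order [n / k^2] and [z = g / k]: the random rotations relax each
    of the quartic sums at rate [1 / n]. It contracts in mean by a factor
    [1 - 1 / (264 n k)] per step, and lies between [|V|^2] and [n |V|^2]; thus
    the mean length of the curve decays by a factor [n] every [O (n k log n)]
    steps. *)

Require Import Defs.
From HB Require Import structures.
From mathcomp Require Import all_boot all_order all_algebra.
From mathcomp Require Import all_classical all_reals all_analysis.
From mathcomp Require Import measurable_realfun.
From mathcomp Require Import ring lra.

Set Implicit Arguments.
Unset Strict Implicit.
Unset Printing Implicit Defensive.

Import Order.TTheory GRing.Theory Num.Theory.
Import numFieldNormedType.Exports.

Local Open Scope classical_set_scope.
Local Open Scope ring_scope.

(** * Rotations of two rows of a matrix *)

Section algebra.
Variable R : realFieldType.

(** [rotation] with free [c] and [s] in place of cosine and sine: the algebra then holds over any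
    real field and uses only polynomial relations between them. *)
Definition givens n (i l : 'I_n) (c s : R) : 'M[R]_n :=
  1%:M + (c - 1) *: (delta_mx i i + delta_mx l l)
  + s *: delta_mx i l - s *: delta_mx l i.

Definition skew n (i l : 'I_n) : 'M[R]_n := delta_mx i l - delta_mx l i.

Definition rdot n k (P Q : 'M[R]_(n, k)) (i l : 'I_n) : R :=
  \sum_j P i j * Q l j.

Definition sqn n k (P : 'M[R]_(n, k)) (i : 'I_n) : R := rdot P P i i.

Definition sqnorm n k (P : 'M[R]_(n, k)) : R := \sum_i sqn P i.

(** With [P = X] and [Q] equal to [V], [X *m V^T] or [X], these are the three row sums of the
    Lyapunov function. Row [i] of [X *m V^T] is V x_i, hence the two widths. *)
Definition rowprod n k m (P : 'M[R]_(n, k)) (Q : 'M[R]_(n, m)) : R :=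
  \sum_i sqn P i * sqn Q i.

Lemma rdotC n k (P Q : 'M[R]_(n, k)) i l : rdot P Q i l = rdot Q P l i.
Proof. by apply: eq_bigr => j _; rewrite mulrC. Qed.

Lemma rdotE n k (P Q : 'M[R]_(n, k)) i l : rdot P Q i l = (P *m Q^T) i l.
Proof. by rewrite mxE; apply: eq_bigr => j _; rewrite mxE. Qed.

Lemma sqnE n k (P : 'M[R]_(n, k)) i : sqn P i = \sum_j P i j ^+ 2.
Proof. by apply: eq_bigr => j _; rewrite expr2. Qed.

Lemma sqn_ge0 n k (P : 'M[R]_(n, k)) i : 0 <= sqn P i.
Proof. by rewrite sqnE sumr_ge0// => j _; rewrite sqr_ge0. Qed.

Lemma sqnorm_ge0 n k (P : 'M[R]_(n, k)) : 0 <= sqnorm P.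
Proof. by rewrite sumr_ge0// => i _; exact: sqn_ge0. Qed.

Lemma rowprod_ge0 n k m (P : 'M[R]_(n, k)) (Q : 'M[R]_(n, m)) :
  0 <= rowprod P Q.
Proof. by rewrite sumr_ge0// => i _; rewrite mulr_ge0// sqn_ge0. Qed.

Lemma sqn_le_sqnorm n k (P : 'M[R]_(n, k)) i : sqn P i <= sqnorm P.
Proof.
by rewrite /sqnorm (bigD1 i)//= lerDl sumr_ge0// => j _; exact: sqn_ge0.
Qed.

Lemma sqnormE n k (P : 'M[R]_(n, k)) : sqnorm P = \tr (P *m P^T).
Proof. by apply: eq_bigr => i _; rewrite /sqn rdotE. Qed.

Lemma sqnorm_tr n k (P : 'M[R]_(n, k)) : sqnorm P^T = sqnorm P.
Proof. by rewrite !sqnormE trmxK mxtrace_mulC. Qed.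

(** Lagrange's identity: the defect is half of the sum of the squares
    [(f i * g j - f j * g i) ^+ 2]. *)
Lemma sum_CS (I : finType) (f g : I -> R) :
  (\sum_i f i * g i) ^+ 2 <= (\sum_i f i ^+ 2) * (\sum_i g i ^+ 2).
Proof.
have : 0 <= \sum_i \sum_j (f i * g j - f j * g i) ^+ 2.
  by rewrite sumr_ge0// => i _; rewrite sumr_ge0// => j _; rewrite sqr_ge0.
have -> : \sum_i \sum_j (f i * g j - f j * g i) ^+ 2 =
    2 * ((\sum_i f i ^+ 2) * (\sum_i g i ^+ 2) - (\sum_i f i * g i) ^+ 2).
  rewrite mulrBr expr2 mulr_natl mulr2n [X in _ + X - _]mulrC.
  rewrite !mulr_suml -!big_split/= mulr_sumr -sumrB; apply: eq_bigr => i _.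
  rewrite !mulr_sumr -!big_split/= -sumrB; apply: eq_bigr => j _.
  by ring.
by rewrite pmulr_rge0// subr_ge0.
Qed.

Lemma rdot_CS n k (P Q : 'M[R]_(n, k)) i l :
  rdot P Q i l ^+ 2 <= sqn P i * sqn Q l.
Proof. by rewrite !sqnE; exact: sum_CS. Qed.

Lemma sqnorm_mul_isom n k m (X : 'M[R]_(n, k)) (Q : 'M[R]_(k, m)) :
  X^T *m X = 1%:M -> sqnorm (X *m Q) = sqnorm Q.
Proof.
move=> XX; rewrite !sqnormE trmx_mul mulmxA -mulmxA mxtrace_mulC.
by rewrite mulmxA -(mulmxA Q^T) XX mulmx1 mxtrace_mulC.
Qed.

Lemma sqn_mul_isom n k m (X : 'M[R]_(n, k)) (Q : 'M[R]_(m, k)) i :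
  X^T *m X = 1%:M -> sqn (Q *m X^T) i = sqn Q i.
Proof.
move=> XX; rewrite /sqn !rdotE trmx_mul trmxK mulmxA -(mulmxA Q).
by rewrite XX mulmx1.
Qed.

(** Right multiplication by [X^T] preserves the norms of rows, and the [rdot Q X i l] are the
    entries of row [i] of [Q *m X^T]. *)
Lemma sum_rdot_isom n k (X : 'M[R]_(n, k)) (Q : 'M[R]_(n, k)) i :
  X^T *m X = 1%:M -> \sum_l rdot Q X i l ^+ 2 = sqn Q i.
Proof.
move=> XX; rewrite -(sqn_mul_isom Q i XX) sqnE.
by apply: eq_bigr => l _; rewrite rdotE.
Qed.

Lemma sqnormB n k (P Q : 'M[R]_(n, k)) :
  sqnorm (P - Q) = sqnorm P + sqnorm Q - 2 * \sum_i rdot P Q i i.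
Proof.
rewrite /sqnorm mulr_sumr -big_split -sumrB/=; apply: eq_bigr => i _.
rewrite /sqn /rdot mulr_sumr -big_split -sumrB/=; apply: eq_bigr => j _.
by rewrite mxE [X in _ + X]mxE; ring.
Qed.

(* [||Q||^2 - ||X^T Q||^2 = ||(1 - X X^T) Q||^2] *)
Lemma sqnorm_tr_isom_le n k m (X : 'M[R]_(n, k)) (Q : 'M[R]_(n, m)) :
  X^T *m X = 1%:M -> sqnorm (X^T *m Q) <= sqnorm Q.
Proof.
move=> XX; have := sqnorm_ge0 (Q - X *m (X^T *m Q)).
rewrite sqnormB sqnorm_mul_isom//.
have -> : \sum_i rdot Q (X *m (X^T *m Q)) i i = sqnorm (X^T *m Q).
  rewrite sqnormE mxtrace_mulC trmx_mul trmxK -mulmxA mxtrace_mulC.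
  by apply: eq_bigr => i _; rewrite rdotC rdotE -mulmxA.
lra.
Qed.

Lemma sqn_isom_le1 n k (X : 'M[R]_(n, k)) i :
  X^T *m X = 1%:M -> sqn X i <= 1.
Proof.
move=> XX; have : sqn X i ^+ 2 <= sqn X i.
  rewrite -[leRHS](sum_rdot_isom X i XX) (bigD1 i)//= lerDl sumr_ge0// => l _.
  exact: sqr_ge0.
have := sqn_ge0 X i; nra.
Qed.

Lemma sqnorm_isom n k (X : 'M[R]_(n, k)) :
  X^T *m X = 1%:M -> sqnorm X = k%:R.
Proof. by move=> XX; rewrite sqnormE mxtrace_mulC XX mxtrace1. Qed.

Lemma delta_mulE n k (a b : 'I_n) (P : 'M[R]_(n, k)) m j :
  (delta_mx a b *m P) m j = (m == a)%:R * P b j.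
Proof.
rewrite mxE (bigD1 b)//= big1 ?addr0 ?mxE ?eqxx ?andbT// => r rb.
by rewrite mxE (negbTE rb) andbF mul0r.
Qed.

Lemma rot_rowE n k (i l : 'I_n) c s (P : 'M[R]_(n, k)) m j : i != l ->
  (givens i l c s *m P) m j =
  if m == i then c * P i j + s * P l j
  else if m == l then - s * P i j + c * P l j else P m j.
Proof.
move=> il; rewrite /givens mulmxBl !mulmxDl mul1mx -!scalemxAl mulmxDl.
move: (delta_mulE i i P m j) (delta_mulE l l P m j).
move: (delta_mulE i l P m j) (delta_mulE l i P m j).
move: (delta_mx i i *m P) (delta_mx l l *m P) (delta_mx i l *m P).
move: (delta_mx l i *m P) => d1 d2 d3 d4; rewrite !mxE => -> -> -> ->.
have [->|mi] := eqVneq m i; first by rewrite (negbTE il) /=; ring.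
by have [->|ml] := eqVneq m l => /=; ring.
Qed.

Lemma skew_rowE n k (i l : 'I_n) (P : 'M[R]_(n, k)) m j : i != l ->
  (skew i l *m P) m j =
  if m == i then P l j else if m == l then - P i j else 0.
Proof.
move=> il; rewrite /skew mulmxBl.
move: (delta_mulE i l P m j) (delta_mulE l i P m j).
move: (delta_mx i l *m P) (delta_mx l i *m P) => d1 d2; rewrite !mxE => -> ->.
have [->|mi] := eqVneq m i; first by rewrite (negbTE il) /=; ring.
by have [_|_] := eqVneq m l => /=; ring.
Qed.

(** Both factors act in the plane of the rows [i] and [l], where rotations commute with their
    generator. The velocity may thus be corrected before or after the rotation. *)
Lemma rot_skewC n k (i l : 'I_n) c s (P : 'M[R]_(n, k)) : i != l ->
  givens i l c s *m (skew i l *m P) = skew i l *m (givens i l c s *m P).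
Proof.
move=> il; apply/matrixP => m j; rewrite rot_rowE// !skew_rowE// !rot_rowE//.
rewrite !eqxx ?(eq_sym l i) ?(negbTE il).
case: ifP => mi; last case: ifP => ml; rewrite ?mi ?ml; by ring.
Qed.

Lemma sum_two n (i l : 'I_n) (f : 'I_n -> R) : i != l ->
  \sum_m f m = f i + f l + \sum_(m | (m != i) && (m != l)) f m.
Proof.
move=> il; rewrite (bigD1 i)//= (bigD1 l)/=; last by rewrite eq_sym.
by rewrite addrA.
Qed.

(** * Row norms and row sums after a rotation of two rows *)

Section rotated.
Variables (n : nat) (i l : 'I_n) (c s : R).
Hypotheses (il : i != l) (cs : c ^+ 2 + s ^+ 2 = 1).
Local Notation T P := (givens i l c s *m P).

Lemma rdot_rot k (P Q : 'M[R]_(n, k)) m r :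
  rdot (T P) Q m r =
  if m == i then c * rdot P Q i r + s * rdot P Q l r
  else if m == l then - s * rdot P Q i r + c * rdot P Q l r else rdot P Q m r.
Proof.
rewrite /rdot; under eq_bigr => j _ do rewrite rot_rowE//.
case: ifP => _; last case: ifP => _ //.
  by rewrite !mulr_sumr -big_split/=; apply: eq_bigr => j _; ring.
by rewrite !mulr_sumr -big_split/=; apply: eq_bigr => j _; ring.
Qed.

Lemma sqn_rot1 k (P : 'M[R]_(n, k)) :
  sqn (T P) i = c ^+ 2 * sqn P i + c * s * rdot P P i l *+ 2 + s ^+ 2 * sqn P l.
Proof.
rewrite /sqn rdot_rot eqxx !(rdotC P (T P)) !rdot_rot eqxx.
by rewrite (rdotC P P l i); ring.
Qed.

Lemma sqn_rot2 k (P : 'M[R]_(n, k)) :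
  sqn (T P) l = s ^+ 2 * sqn P i - c * s * rdot P P i l *+ 2 + c ^+ 2 * sqn P l.
Proof.
rewrite /sqn rdot_rot eqxx (eq_sym l i) (negbTE il) !(rdotC P (T P)) !rdot_rot.
by rewrite eqxx (eq_sym l i) (negbTE il) (rdotC P P l i); ring.
Qed.

Lemma sqn_rot_out k (P : 'M[R]_(n, k)) m : m != i -> m != l ->
  sqn (T P) m = sqn P m.
Proof.
move=> /negbTE mi /negbTE ml.
by rewrite /sqn rdot_rot mi ml rdotC rdot_rot mi ml.
Qed.

Lemma sqn_rot_pair k (P : 'M[R]_(n, k)) :
  sqn (T P) i + sqn (T P) l = sqn P i + sqn P l.
Proof.
rewrite sqn_rot1 sqn_rot2 -[in RHS](mul1r (sqn P i)) -[in RHS](mul1r (sqn P l)).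
by rewrite -cs; ring.
Qed.

Lemma sqnorm_rot k (P : 'M[R]_(n, k)) : sqnorm (T P) = sqnorm P.
Proof.
rewrite /sqnorm !(sum_two _ il) sqn_rot_pair; congr (_ + _).
by apply: eq_bigr => m /andP[mi ml]; rewrite sqn_rot_out.
Qed.

Lemma rowprod_rot k m (P : 'M[R]_(n, k)) (Q : 'M[R]_(n, m)) :
  rowprod (T P) (T Q) = rowprod P Q - (sqn P i * sqn Q i + sqn P l * sqn Q l)
    + (sqn (T P) i * sqn (T Q) i + sqn (T P) l * sqn (T Q) l).
Proof.
rewrite /rowprod !(sum_two _ il).
under eq_bigr => r /andP[ri rl] do rewrite !sqn_rot_out//.
by ring.
Qed.

End rotated.

(* The rotations (c, s) and (c', s') differ by an angle pi/4, so that their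
   average already is the average over all the angles. *)
Lemma rowprod_rot_avg n (i l : 'I_n) (c s c' s' : R) k m
    (P : 'M[R]_(n, k)) (Q : 'M[R]_(n, m)) : i != l ->
  c ^+ 2 + s ^+ 2 = 1 -> c' ^+ 2 = 2^-1 - c * s -> s' ^+ 2 = 2^-1 + c * s ->
  c' * s' = c ^+ 2 - 2^-1 ->
  rowprod (givens i l c s *m P) (givens i l c s *m Q)
    + rowprod (givens i l c' s' *m P) (givens i l c' s' *m Q)
  = 2 * (rowprod P Q - 4^-1 * (sqn P i - sqn P l) * (sqn Q i - sqn Q l)
         + rdot P P i l * rdot Q Q i l).
Proof.
move=> il cs c2 s2 cs2; rewrite !rowprod_rot//.
rewrite !sqn_rot1// !sqn_rot2// c2 s2 cs2.
have -> : s ^+ 2 = 1 - c ^+ 2 by rewrite -cs; ring.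
have key : (c * s) ^+ 2 - c ^+ 2 + c ^+ 2 * c ^+ 2 = 0.
  by rewrite exprMn (_ : s ^+ 2 = 1 - c ^+ 2); [ring | rewrite -cs; ring].
move: key; set u := c ^+ 2; set v := c * s => key.
set a := sqn P i; set b := sqn P l; set g := rdot P P i l.
set A := sqn Q i; set B := sqn Q l; set G := rdot Q Q i l.
apply/eqP; rewrite -subr_eq0; apply/eqP.
(* The two sides differ by a multiple of the only relation between [u] and [v], namely c^2 s^2 = c^2
   (1 - c^2). *)
transitivity (2 * ((a - b) / 2 * ((A - B) / 2) + g * G) * 4
  * (v ^+ 2 - u + u * u)); last by rewrite key mulr0.
by field.
Qed.

Definition pairsum n (f : 'I_n -> 'I_n -> R) : R :=
  \sum_(p : 'I_n * 'I_n | (p.1 < p.2)%N) f p.1 p.2.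

(** Turns sums over pairs into full double sums, where the identities for isometries apply, at the
    cost of the diagonal. *)
Lemma pairsum_sym n (f : 'I_n -> 'I_n -> R) : (forall i l, f i l = f l i) ->
  2 * pairsum f = \sum_i \sum_l f i l - \sum_i f i i.
Proof.
move=> fC.
have pE (g : 'I_n -> 'I_n -> bool) :
    \sum_(p : 'I_n * 'I_n | g p.1 p.2) f p.1 p.2 = \sum_i \sum_(l | g i l) f i l.
  by rewrite pair_big_dep.
rewrite /pairsum (pE (fun i l => (i < l)%N)) mulr2n mulrDl mul1r.
rewrite [X in _ + X](exchange_big_dep predT)//= -big_split/= -sumrB; apply: eq_bigr => i _.
rewrite [in RHS](bigD1 i)//= [RHS]addrC addKr.
rewrite [RHS](bigID (fun l : 'I_n => (i < l)%N))/=; congr (_ + _).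
  apply: eq_bigl => l; rewrite -val_eqE/= andbC.
  by have [/= il|] := ltnP i l => //=; rewrite neq_ltn il orbT.
apply: eq_big => [l|l _]; last exact: fC.
by rewrite -val_eqE/= -leqNgt ltn_neqAle.
Qed.

End algebra.
Arguments skew {R n} i l.

(** * One step of the coupling *)

Section drift.
Variable R : realFieldType.

(** * Effect of an angular velocity on the velocity of the curve *)

Section skew.
Variables (n k : nat) (i l : 'I_n) (sg : R) (X V : 'M[R]_(n, k)).
Hypothesis il : i != l.
Local Notation V' := (V + sg *: (skew i l *m X)).

Lemma rdot_skew (P : 'M[R]_(n, k)) m r :
  rdot P V' m r =
  if r == i then rdot P V m i + sg * rdot P X m l
  else if r == l then rdot P V m l - sg * rdot P X m i else rdot P V m r.
Proof.
rewrite /rdot.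
under eq_bigr => j _ do rewrite 2!mxE skew_rowE// mulrDr.
rewrite big_split/=; case: eqP => [->|_].
  by rewrite mulr_sumr; congr (_ + _); apply: eq_bigr => j _; ring.
case: eqP => [->|_]; last by rewrite [X in _ + X]big1 ?addr0// => j _; ring.
by rewrite mulr_sumr -sumrN; congr (_ + _); apply: eq_bigr => j _; ring.
Qed.

Lemma sqn_skew1 : sqn V' i = sqn V i + sg * rdot V X i l *+ 2 + sg ^+ 2 * sqn X l.
Proof.
rewrite /sqn rdot_skew eqxx 2!(rdotC V') !rdot_skew eqxx (rdotC X V).
by ring.
Qed.

Lemma sqn_skew2 : sqn V' l = sqn V l - sg * rdot V X l i *+ 2 + sg ^+ 2 * sqn X i.
Proof.
rewrite /sqn rdot_skew eqxx eq_sym (negbTE il) 2!(rdotC V') !rdot_skew eqxx.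
by rewrite eq_sym (negbTE il) (rdotC X V); ring.
Qed.

Lemma sqn_skew_out m : m != i -> m != l -> sqn V' m = sqn V m.
Proof.
move=> /negbTE mi /negbTE ml.
by rewrite /sqn rdot_skew mi ml rdotC rdot_skew mi ml.
Qed.

Lemma sqnorm_skew : sqnorm V' = sqnorm V
  + sg * (rdot V X i l - rdot V X l i) *+ 2 + sg ^+ 2 * (sqn X i + sqn X l).
Proof.
rewrite /sqnorm !(sum_two _ il) sqn_skew1 sqn_skew2.
under eq_bigr => r /andP[ri rl] do rewrite sqn_skew_out//.
by ring.
Qed.

Lemma rowprod_skew : rowprod X V' = rowprod X V
  + sqn X i * (sg * rdot V X i l *+ 2 + sg ^+ 2 * sqn X l)
  + sqn X l * (sg ^+ 2 * sqn X i - sg * rdot V X l i *+ 2).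
Proof.
rewrite /rowprod !(sum_two _ il) sqn_skew1 sqn_skew2.
under eq_bigr => r /andP[ri rl] do rewrite sqn_skew_out//.
by ring.
Qed.

End skew.

(** Young's inequality: expanding |v_i - 32 sg x_l|^2 >= 0 and |v_l + 32 sg x_i|^2 >= 0 absorbs the
    cross terms. The share 1/32 is small enough to be beaten later by the relaxation of
    [sum_rowprod_rot_le]. *)
Lemma rowprod_skew_le n k (i l : 'I_n) (sg : R) (X V : 'M[R]_(n, k)) : i != l ->
  rowprod X (V + sg *: (skew i l *m X)) <= rowprod X V
  + 32^-1 * (sqn X i * sqn V i + sqn X l * sqn V l)
  + 33 * sg ^+ 2 * (sqn X i * sqn X l *+ 2).
Proof.
move=> il; rewrite rowprod_skew//.
have := sqn_ge0 (V + (- 32 * sg) *: (skew i l *m X)) i.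
rewrite sqn_skew1// => h1.
have := sqn_ge0 (V + (- 32 * sg) *: (skew i l *m X)) l.
rewrite sqn_skew2// => h2.
have := mulr_ge0 (sqn_ge0 X i) h1; have := mulr_ge0 (sqn_ge0 X l) h2.
set a := sqn X i; set b := sqn X l; set u := rdot V X i l; set w := rdot V X l i.
set s := sqn V i; set t := sqn V l; lra.
Qed.

(** The part of [rowprod X (X *m V^T)] due to row [r] of [V]; an angular velocity in the plane of
    [i] and [l] changes only two of these parts. *)
Definition wrow n k (X V : 'M[R]_(n, k)) r := \sum_m sqn X m * rdot X V m r ^+ 2.

Lemma wrow_ge0 n k (X V : 'M[R]_(n, k)) r : 0 <= wrow X V r.
Proof. by rewrite sumr_ge0// => m _; rewrite mulr_ge0 ?sqr_ge0 ?sqn_ge0. Qed.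

Lemma rowprod_mulmx n k (X V : 'M[R]_(n, k)) :
  rowprod X (X *m V^T) = \sum_r wrow X V r.
Proof.
rewrite /wrow exchange_big/=; apply: eq_bigr => m _.
rewrite sqnE mulr_sumr; apply: eq_bigr => r _; rewrite rdotE//.
Qed.

Lemma wrow_self_le n k (X : 'M[R]_(n, k)) r : wrow X X r <= sqn X r * rowprod X X.
Proof.
rewrite mulr_sumr ler_sum// => m _.
have := ler_wpM2l (sqn_ge0 X m) (rdot_CS X X m r); lra.
Qed.

Lemma sqrD_le (u w : R) : (u + w) ^+ 2 <= 33 / 32 * u ^+ 2 + 33 * w ^+ 2.
Proof. by have := sqr_ge0 (u - 32 * w); nra. Qed.

(** Only the parts [wrow] of the rows [i] and [l] change; [sqrD_le] separates the correction from
    [V], and Cauchy-Schwarz ([wrow_self_le]) bounds the correction. *)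
Lemma rowprod_mul_skew_le n k (i l : 'I_n) (sg : R) (X V : 'M[R]_(n, k)) :
  i != l ->
  rowprod X (X *m (V + sg *: (skew i l *m X))^T) <= rowprod X (X *m V^T)
  + 32^-1 * (wrow X V i + wrow X V l)
  + 33 * sg ^+ 2 * ((sqn X i + sqn X l) * rowprod X X).
Proof.
move=> il; set V' := V + _; rewrite !rowprod_mulmx !(sum_two _ il).
have wi : wrow X V' i <= 33 / 32 * wrow X V i + 33 * sg ^+ 2 * wrow X X l.
  rewrite /wrow !mulr_sumr -big_split/= ler_sum// => m _.
  rewrite rdot_skew// eqxx.
  have := ler_wpM2l (sqn_ge0 X m) (sqrD_le (rdot X V m i) (sg * rdot X X m l)).
  by move/le_trans; apply; rewrite exprMn le_eqVlt; apply/orP/or_introl/eqP; ring.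
have wl : wrow X V' l <= 33 / 32 * wrow X V l + 33 * sg ^+ 2 * wrow X X i.
  rewrite /wrow !mulr_sumr -big_split/= ler_sum// => m _.
  rewrite rdot_skew// eqxx eq_sym (negbTE il).
  have := ler_wpM2l (sqn_ge0 X m) (sqrD_le (rdot X V m l) (- (sg * rdot X X m i))).
  move/le_trans; apply.
  by rewrite sqrrN exprMn le_eqVlt; apply/orP/or_introl/eqP; ring.
have -> : \sum_(m | (m != i) && (m != l)) wrow X V' m
        = \sum_(m | (m != i) && (m != l)) wrow X V m.
  apply: eq_bigr => r /andP[/negbTE ri /negbTE rl].
  by apply: eq_bigr => m _; rewrite rdot_skew// ri rl.
have s2 : 0 <= 33 * sg ^+ 2 by rewrite mulr_ge0 ?sqr_ge0.
have := ler_wpM2l s2 (wrow_self_le X i); have := ler_wpM2l s2 (wrow_self_le X l).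
move: wi wl.
set a := wrow X V' i; set b := wrow X V' l; set A := wrow X V i.
set B := wrow X V l; set D := 33 * sg ^+ 2; set E := wrow X X i.
set G := wrow X X l; set M := rowprod X X; set S := \sum_(_ | _) _.
lra.
Qed.

(** * Row sums of a rotated frame against the unrotated ones *)

Section rotated.
Variables (n k : nat) (i l : 'I_n) (c s : R) (X V : 'M[R]_(n, k)).
Hypotheses (il : i != l) (cs : c ^+ 2 + s ^+ 2 = 1) (XX : X^T *m X = 1%:M).
Local Notation T P := (givens i l c s *m P).
Let q := sqn X i + sqn X l.

Lemma rdot_rotr_pair (P Q : 'M[R]_(n, k)) m :
  rdot P (T Q) m i ^+ 2 + rdot P (T Q) m l ^+ 2 =
  rdot P Q m i ^+ 2 + rdot P Q m l ^+ 2.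
Proof.
rewrite !(rdotC P) !rdot_rot// !eqxx (eq_sym l i) (negbTE il).
set u := rdot Q P i m; set v := rdot Q P l m.
rewrite -[RHS]mul1r -cs; ring.
Qed.

(** The transposed rotation on the right mixes two columns of the product and preserves the norms of
    its rows. *)
Lemma rowprod_rot_mulmx : rowprod (T X) (T X *m (T V)^T)
  = rowprod (T X) (T (X *m V^T)).
Proof.
apply: eq_bigr => m _; congr (_ * _); rewrite !sqnE.
under eq_bigr => r _ do rewrite -rdotE.
under [RHS]eq_bigr => r _ do rewrite mulmxA -rdotE.
rewrite !(sum_two _ il) rdot_rotr_pair; congr (_ + _).
apply: eq_bigr => r /andP[/negbTE ri /negbTE rl].
by rewrite rdotC rdot_rot// ri rl rdotC.
Qed.

Lemma sqn_rot_le : sqn (T X) i <= q /\ sqn (T X) l <= q.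
Proof.
have := sqn_rot_pair il cs X; have := sqn_ge0 (T X) i; have := sqn_ge0 (T X) l.
by rewrite -/q => ? ? ?; split; lra.
Qed.

(** Only the weights of the rows [i] and [l] change, and they stay below [q]; the squares that they
    multiply sum up to at most |v_r|^2 since [X] is an isometry. *)
Lemma wrow_rot_le r : wrow (T X) V r <= wrow X V r + q * sqn V r.
Proof.
rewrite /wrow !(sum_two _ il).
have -> : \sum_(m | (m != i) && (m != l)) sqn (T X) m * rdot (T X) V m r ^+ 2
        = \sum_(m | (m != i) && (m != l)) sqn X m * rdot X V m r ^+ 2.
  apply: eq_bigr => m /andP[mi ml]; rewrite sqn_rot_out// rdot_rot//.
  by rewrite (negbTE mi) (negbTE ml).
have [qi ql] := sqn_rot_le.
have vr : rdot V X r i ^+ 2 + rdot V X r l ^+ 2 <= sqn V r.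
  rewrite -(sum_rdot_isom V r XX) (sum_two _ il) lerDl sumr_ge0// => m _.
  exact: sqr_ge0.
have pr := rdot_rotr_pair V X r.
rewrite !(rdotC V) in vr pr.
have q0 : 0 <= q by rewrite addr_ge0 ?sqn_ge0.
have := ler_wpM2r (sqr_ge0 (rdot (T X) V i r)) qi.
have := ler_wpM2r (sqr_ge0 (rdot (T X) V l r)) ql.
have := ler_wpM2l q0 vr; rewrite -pr.
have := mulr_ge0 (sqn_ge0 X i) (sqr_ge0 (rdot X V i r)).
have := mulr_ge0 (sqn_ge0 X l) (sqr_ge0 (rdot X V l r)).
rewrite mulrDr; set S := \sum_(_ | _) _; lra.
Qed.

Lemma wrow_rotr_pair (P : 'M[R]_(n, k)) :
  wrow P (T V) i + wrow P (T V) l = wrow P V i + wrow P V l.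
Proof.
rewrite /wrow -!big_split/=; apply: eq_bigr => m _.
by rewrite -!mulrDr rdot_rotr_pair.
Qed.

(** With [a' + b' = a + b] one has a'^2 + b'^2 <= (a + b)^2 <= 2 (a^2 + b^2). *)
Lemma rowprod_rot_self_le : rowprod (T X) (T X) <= 2 * rowprod X X.
Proof.
rewrite rowprod_rot//.
have : sqn X i * sqn X i + sqn X l * sqn X l <= rowprod X X.
  rewrite /rowprod (sum_two _ il) lerDl sumr_ge0// => m _.
  by rewrite mulr_ge0 ?sqn_ge0.
have := sqn_rot_pair il cs X.
have := mulr_ge0 (sqn_ge0 (T X) i) (sqn_ge0 (T X) l).
have := sqr_ge0 (sqn X i - sqn X l).
set a := sqn X i; set b := sqn X l; set a' := sqn (T X) i; set b' := sqn (T X) l.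
move=> h1 h2 h3.
have : (a' + b') ^+ 2 = (a + b) ^+ 2 by rewrite h3.
nra.
Qed.

End rotated.

Definition tang n k (X V : 'M[R]_(n, k)) i l := rdot V X i l - rdot V X l i.

Definition angvel d n k (X V : 'M[R]_(n, k)) i l :=
  - tang X V i l / (sqn X i + sqn X l + d).

Definition damped d n k (X V : 'M[R]_(n, k)) i l :=
  V + angvel d X V i l *: (skew i l *m X).

Definition wenergy n k (X V : 'M[R]_(n, k)) :=
  rowprod X V + rowprod X (X *m V^T).

Definition lyap g z n k (X V : 'M[R]_(n, k)) :=
  sqnorm V + g * wenergy X V + z * (sqnorm V * rowprod X X).

(** * Bounds for a single pair and a single angle *)

Section pointwise.
Variables (n k : nat) (i l : 'I_n) (d c s : R) (X V : 'M[R]_(n, k)).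
Hypotheses (il : i != l) (d0 : 0 < d) (XX : X^T *m X = 1%:M).
Let q := sqn X i + sqn X l.
Let A := tang X V i l.

(** An angular velocity [sg] changes |V|^2 by 2 sg A + sg^2 q. The minimiser - A / q would be too
    large for light rows; adding [d] to the denominator keeps it under control and still gives the
    drop A^2 / (q + d), with A^2 d / (q + d)^2 to spare. *)
Lemma sqnorm_damped_le : sqnorm (damped d X V i l) <= sqnorm V - A ^+ 2 / (q + d).
Proof.
have q0 : 0 <= q by rewrite addr_ge0 ?sqn_ge0.
have qd : 0 < q + d by rewrite ltr_wpDl.
rewrite /damped sqnorm_skew// -/q -/(tang X V i l) -/A /angvel -/q -/A.
rewrite -subr_ge0 [leRHS](_ : _ = A ^+ 2 * d / (q + d) ^+ 2); last first.
  by field; rewrite gt_eqF.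
by rewrite divr_ge0 ?sqr_ge0// mulr_ge0 ?sqr_ge0 ?ltW.
Qed.

Lemma sqnorm_damped_leN : sqnorm (damped d X V i l) <= sqnorm V.
Proof.
apply: (le_trans sqnorm_damped_le); rewrite gerBl divr_ge0 ?sqr_ge0//.
by rewrite addr_ge0 ?(ltW d0)// addr_ge0 ?sqn_ge0.
Qed.

(** This is 4 q d <= (q + d)^2. *)
Lemma angvel_q_le : angvel d X V i l ^+ 2 * q <= A ^+ 2 / (4 * d).
Proof.
have q0 : 0 <= q by rewrite addr_ge0 ?sqn_ge0.
have qd : 0 < q + d by rewrite ltr_wpDl.
rewrite /angvel -/q -/A -subr_ge0.
rewrite [leRHS](_ : _ = A ^+ 2 * (q - d) ^+ 2 / (4 * d * (q + d) ^+ 2)).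
  by apply: divr_ge0; apply: mulr_ge0; rewrite ?sqr_ge0 ?pmulr_rge0 ?ltW.
by field; rewrite !gt_eqF.
Qed.

Lemma angvel_q2_le : angvel d X V i l ^+ 2 * q ^+ 2 <= A ^+ 2 * q / (4 * d).
Proof.
have q0 : 0 <= q by rewrite addr_ge0 ?sqn_ge0.
have := ler_wpM2r q0 angvel_q_le.
by rewrite (mulrAC (A ^+ 2)) => /(le_trans _); apply; rewrite (expr2 q) mulrA.
Qed.

Local Notation T P := (givens i l c s *m P).

(** By [rot_skewC] the correction acts on the rotated frame with the same angular velocity, so the
    Young bounds apply there. The right-hand side depends on the angle only through row sums of the
    rotated but undamped matrices, which [rowprod_rot_avg] can average. *)
Lemma lyap_step_le g z : c ^+ 2 + s ^+ 2 = 1 -> 0 <= g -> 0 <= z ->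
  lyap g z (T X) (T (damped d X V i l)) <=
  sqnorm V - A ^+ 2 / (q + d)
  + g * (rowprod (T X) (T V) + rowprod (T X) (T (X *m V^T))
         + 32^-1 * (q * (sqn V i + sqn V l) *+ 2 + (wrow X V i + wrow X V l))
         + 33 * (A ^+ 2 * q / (8 * d) + A ^+ 2 / (2 * d) * rowprod X X))
  + z * (sqnorm V * rowprod (T X) (T X)).
Proof.
move=> cs g0 z0; rewrite /lyap.
set sg := angvel d X V i l.
have TmE : T (damped d X V i l) = T V + sg *: (skew i l *m T X).
  by rewrite /damped mulmxDr -scalemxAr rot_skewC.
apply: lerD; first apply: lerD.
- by rewrite sqnorm_rot// sqnorm_damped_le.
- apply: ler_wpM2l => //; rewrite /wenergy TmE.
  have h1 := rowprod_skew_le sg (T X) (T V) il.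
  have h2 := rowprod_mul_skew_le sg (T X) (T V) il.
  rewrite wrow_rotr_pair// rowprod_rot_mulmx// in h2.
  have wi := wrow_rot_le V il cs XX i; have wl := wrow_rot_le V il cs XX l.
  rewrite -/q in wi wl.
  have [qi ql] := sqn_rot_le X il cs; rewrite -/q in qi ql.
  have vp := sqn_rot_pair il cs V; have xp := sqn_rot_pair il cs X.
  have mi := ler_wpM2r (sqn_ge0 (T V) i) qi.
  have ml := ler_wpM2r (sqn_ge0 (T V) l) ql.
  have m2 := rowprod_rot_self_le X il cs.
  have s1 := angvel_q_le; have s2 := angvel_q2_le; rewrite -/sg in s1 s2.
  have M0 := rowprod_ge0 X X.
  have sM := ler_wpM2r M0 s1.
  have sq0 : 0 <= sg ^+ 2 * q by rewrite mulr_ge0 ?sqr_ge0 ?addr_ge0 ?sqn_ge0.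
  have sM2 := ler_wpM2l sq0 m2.
  have ab : sqn (T X) i * sqn (T X) l *+ 2 <= q ^+ 2 / 2.
    have := sqr_ge0 (sqn (T X) i - sqn (T X) l).
    by rewrite /q -xp; nra.
  have sab := ler_wpM2l (sqr_ge0 sg) ab.
  rewrite xp -/q in h2.
  have dE1 : A ^+ 2 * q / (4 * d) = 2 * (A ^+ 2 * q / (8 * d)).
    by field; rewrite gt_eqF.
  have dE2 : A ^+ 2 / (4 * d) = 2^-1 * (A ^+ 2 / (2 * d)).
    by field; rewrite gt_eqF.
  rewrite dE1 in s2; rewrite dE2 in sM.
  move: h1 h2 wi wl vp mi ml sM sM2 sab s2.
  move: (A ^+ 2 * q / (8 * d)) (A ^+ 2 / (2 * d)) => D1 D2.
  move: (rowprod (T X) (T V)) (rowprod (T X) (T (X *m V^T))) => r1 r2.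
  move: (rowprod (T X) _) (rowprod (T X) (_ *m _)) => r3 r4.
  move: (rowprod _ _) (rowprod _ _) => r5 r6.
  move: (wrow X V i) (wrow X V l) (wrow _ V i) (wrow _ V l) => w1 w2 w3 w4.
  move: (sqn V i) (sqn V l) (sqn (T V) i) (sqn (T V) l) => v1 v2 v3 v4.
  move: (sqn (T X) i) (sqn (T X) l) => x1 x2.
  move=> h1 h2 h3 h4 h5 h6 h7 h8 h9 h10 h11.
  (* The equality [h5] is needed multiplied by [q]; once expanded it is linear in the products that
     [lra] takes as atoms. *)
  have hv : q * (v3 + v4) = q * (v1 + v2) by rewrite h5.
  rewrite !mulrDr in hv.
  lra.
- apply: ler_wpM2l => //; apply: ler_wpM2r; first exact: rowprod_ge0.
  by rewrite sqnorm_rot// sqnorm_damped_leN.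
Qed.

End pointwise.

End drift.

(** * Contraction of the Lyapunov function *)

Section sums.
Variables (R : realFieldType) (n k : nat) (X V : 'M[R]_(n, k)).
Hypothesis XX : X^T *m X = 1%:M.

Lemma pairsumD (f g : 'I_n -> 'I_n -> R) :
  pairsum (fun i l => f i l + g i l) = pairsum f + pairsum g.
Proof. exact: big_split. Qed.

Lemma pairsumZ a (f : 'I_n -> 'I_n -> R) :
  pairsum (fun i l => a * f i l) = a * pairsum f.
Proof. by rewrite /pairsum mulr_sumr. Qed.

Lemma le_pairsum (f g : 'I_n -> 'I_n -> R) : (forall i l, i != l -> f i l <= g i l) ->
  pairsum f <= pairsum g.
Proof.
by move=> fg; apply: ler_sum => p p12; apply: fg; rewrite -val_eqE/= ltn_eqF.
Qed.

(** The relaxation of a row sum. The products of differences sum up to a covariance, n [rowprod X Q]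
    - k |Q|^2, whence the loss n / 4. The Gram products sum up to at most half of |X^T Q|^2 <=
    |Q|^2, which the last term absorbs as k >= 1. *)
Lemma sum_rowprod_rot_le m (Q : 'M[R]_(n, m)) : (0 < k)%N ->
  pairsum (fun i l => rowprod X Q
     - 4^-1 * (sqn X i - sqn X l) * (sqn Q i - sqn Q l)
     + rdot X X i l * rdot Q Q i l)
  <= (pairsum (fun _ _ : 'I_n => 1) - n%:R / 4) * rowprod X Q
     + 3 / 4 * k%:R * sqnorm Q.
Proof.
move=> k0; set a := sqn X; set b := sqn Q.
have S1 : 2 * pairsum (fun i l => (a i - a l) * (b i - b l)) =
    2 * n%:R * rowprod X Q - 2 * k%:R * sqnorm Q.
  rewrite pairsum_sym => [|i l]; last by ring.
  rewrite [X in _ - X]big1 ?subr0 => [|i _]; last by rewrite subrr mul0r.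
  rewrite -(sqnorm_isom XX).
  transitivity (\sum_i \sum_(l < n) a i * b i + \sum_(i < n) \sum_l a l * b l
    - (\sum_i \sum_l a i * b l + \sum_i \sum_l a l * b i)).
    rewrite -!big_split -sumrB/=; apply: eq_bigr => i _.
    by rewrite -!big_split -sumrB/=; apply: eq_bigr => l _; ring.
  rewrite [X in X + _ - _]exchange_big/= !sumr_const !card_ord.
  rewrite [X in _ - (_ + X)]exchange_big/= /rowprod /sqnorm -/a -/b.
  rewrite -!(mulrA 2) big_distrlr/= -mulr_natl; ring.
have S2 : 2 * pairsum (fun i l => rdot X X i l * rdot Q Q i l) =
    sqnorm (X^T *m Q) - rowprod X Q.
  rewrite pairsum_sym => [|i l]; last by rewrite !(rdotC _ _ i).
  congr (_ - _).
  rewrite sqnormE trmx_mul trmxK -mulmxA mxtrace_mulC mulmxA -(mulmxA (Q *m Q^T)).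
  apply: eq_bigr => i _; rewrite mxE; apply: eq_bigr => l _.
  by rewrite (rdotC X X) !rdotE mulrC.
have := sqnorm_tr_isom_le Q XX; have F0 := rowprod_ge0 X Q; have Q0 := sqnorm_ge0 Q.
have k1 : 1 <= k%:R :> R by rewrite ler1n.
have : 0 <= (k%:R - 1) * sqnorm Q by rewrite mulr_ge0 ?subr_ge0.
have -> : pairsum (fun i l => rowprod X Q
     - 4^-1 * (a i - a l) * (b i - b l) + rdot X X i l * rdot Q Q i l) =
  rowprod X Q * pairsum (fun _ _ : 'I_n => 1)
  - 4^-1 * pairsum (fun i l => (a i - a l) * (b i - b l))
  + pairsum (fun i l => rdot X X i l * rdot Q Q i l).
  rewrite -mulNr -!pairsumZ -!pairsumD; apply: eq_bigr => p _; ring.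
move: S1 S2; set x := pairsum _; set y := pairsum _; lra.
Qed.

Lemma rowprod_le_sqnorm m (Q : 'M[R]_(n, m)) : rowprod X Q <= sqnorm Q.
Proof.
apply: ler_sum => i _; rewrite -[leRHS]mul1r ler_wpM2r ?sqn_ge0//.
exact: sqn_isom_le1.
Qed.

Lemma sqnorm_mulmx_tr : sqnorm (X *m V^T) = sqnorm V.
Proof. by rewrite sqnorm_mul_isom// sqnorm_tr. Qed.

Lemma rowprod_mulmxE :
  rowprod X (X *m V^T) = \sum_i \sum_l sqn X i * rdot V X l i ^+ 2.
Proof.
rewrite rowprod_mulmx exchange_big/=; apply: eq_bigr => i _.
by apply: eq_bigr => l _; rewrite rdotC.
Qed.

Lemma rowprodE : rowprod X V = \sum_i \sum_l sqn X i * rdot V X i l ^+ 2.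
Proof.
by apply: eq_bigr => i _; rewrite -(sum_rdot_isom V i XX) mulr_sumr.
Qed.

(** Tangency makes [X^T *m V] skew, so the cross sum of [rdot V X i l * rdot V X l i] is minus a
    squared norm and adds to the result: the total is at least |V|^2. *)
Lemma sum_tang2 : X^T *m V + V^T *m X = 0 ->
  pairsum (fun i l => tang X V i l ^+ 2) = sqnorm V + sqnorm (X^T *m V).
Proof.
move=> XV; have two : 2 != 0 :> R by rewrite pnatr_eq0.
apply: (mulfI two); rewrite pairsum_sym => [|i l]; last by rewrite /tang; ring.
rewrite [X in _ - X]big1 ?subr0 => [|i _]; last by rewrite /tang subrr expr0n.
transitivity (\sum_i \sum_l rdot V X i l ^+ 2 + \sum_i \sum_l rdot V X l i ^+ 2
  - 2 * \sum_i \sum_l rdot V X i l * rdot V X l i).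
  rewrite mulr_sumr -big_split -sumrB/=; apply: eq_bigr => i _.
  rewrite mulr_sumr -big_split -sumrB/=; apply: eq_bigr => l _.
  by rewrite /tang; ring.
rewrite [X in _ + X - _]exchange_big/=.
have -> : \sum_i \sum_l rdot V X i l ^+ 2 = sqnorm V.
  by apply: eq_bigr => i _; rewrite sum_rdot_isom.
have -> : \sum_i \sum_l rdot V X i l * rdot V X l i = - sqnorm (X^T *m V).
  transitivity (\tr ((V *m X^T) *m (V *m X^T))).
    by apply: eq_bigr => i _; rewrite mxE; apply: eq_bigr => l _; rewrite !rdotE.
  rewrite sqnormE -mulmxA mxtrace_mulC trmx_mul trmxK.
  have -> : V^T *m X = - (X^T *m V) by apply/eqP; rewrite -addr_eq0 addrC XV.
  by rewrite mulmxN linearN opprK/= !mulmxA.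
ring.
Qed.

(** From (u - w)^2 <= 2 (u^2 + w^2), after the symmetry in [i] and [l] has replaced the two weights
    by one. *)
Lemma sum_tang2_q_le :
  pairsum (fun i l => tang X V i l ^+ 2 * (sqn X i + sqn X l))
  <= 2 * wenergy X V.
Proof.
have two : 0 < 2 :> R by [].
rewrite -(ler_pM2l two) pairsum_sym => [|i l]; last by rewrite /tang; ring.
rewrite [X in _ - X]big1 ?subr0 => [|i _]; last by rewrite /tang subrr expr0n mul0r.
have -> : \sum_i \sum_l tang X V i l ^+ 2 * (sqn X i + sqn X l) =
  \sum_i \sum_l tang X V i l ^+ 2 * sqn X i *+ 2.
  transitivity (\sum_i \sum_l tang X V i l ^+ 2 * sqn X i +
    \sum_l \sum_i tang X V i l ^+ 2 * sqn X l).
    rewrite [X in _ + X]exchange_big -big_split/=; apply: eq_bigr => i _.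
    by rewrite -big_split/=; apply: eq_bigr => l _; ring.
  rewrite -big_split/=; apply: eq_bigr => i _.
  rewrite -big_split/=; apply: eq_bigr => l _.
  by rewrite /tang; ring.
rewrite /wenergy rowprodE rowprod_mulmxE mulrA -big_split/= mulr_sumr.
apply: ler_sum => i _; rewrite -big_split/= mulr_sumr; apply: ler_sum => l _.
have := mulr_ge0 (sqn_ge0 X i) (sqr_ge0 (rdot V X i l + rdot V X l i)).
rewrite /tang; lra.
Qed.

Lemma sum_q_sqn_le :
  pairsum (fun i l => (sqn X i + sqn X l) * (sqn V i + sqn V l))
  <= n%:R * rowprod X V + k%:R * sqnorm V.
Proof.
have two : 0 < 2 :> R by [].
rewrite -(ler_pM2l two) pairsum_sym => [|i l]; last by ring.
rewrite -(sqnorm_isom XX).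
have -> : \sum_i \sum_l (sqn X i + sqn X l) * (sqn V i + sqn V l) =
  2 * n%:R * rowprod X V + 2 * (sqnorm X * sqnorm V).
  transitivity (\sum_i \sum_(l < n) sqn X i * sqn V i
    + \sum_(i < n) \sum_l sqn X l * sqn V l
    + (\sum_i \sum_l sqn X i * sqn V l + \sum_i \sum_l sqn X l * sqn V i)).
    rewrite -!big_split/=; apply: eq_bigr => i _.
    by rewrite -!big_split/=; apply: eq_bigr => l _; ring.
  rewrite [X in X + _ + _]exchange_big/= !sumr_const !card_ord.
  rewrite [X in _ + (_ + X)]exchange_big/= big_distrlr/= /rowprod -mulr_natl.
  ring.
have : 0 <= \sum_i (sqn X i + sqn X i) * (sqn V i + sqn V i).
  by rewrite sumr_ge0// => i _; rewrite mulr_ge0 ?addr_ge0 ?sqn_ge0.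
lra.
Qed.

Lemma sum_wrow_le :
  pairsum (fun i l => wrow X V i + wrow X V l) <= n%:R * rowprod X (X *m V^T).
Proof.
have two : 0 < 2 :> R by [].
rewrite -(ler_pM2l two) pairsum_sym => [|i l]; last by rewrite addrC.
rewrite rowprod_mulmx.
have -> : \sum_i \sum_l (wrow X V i + wrow X V l) =
  2 * (n%:R * \sum_r wrow X V r).
  under eq_bigr => i _ do rewrite big_split/=.
  rewrite big_split/= [X in X + _]exchange_big/= !sumr_const !card_ord.
  by rewrite -mulr_natl; ring.
by rewrite gerBl sumr_ge0// => i _; rewrite addr_ge0 ?wrow_ge0.
Qed.

End sums.

(** * Choice of the constants and contraction summed over the pairs *)

Section lyapunov.
Variables (R : realFieldType) (n k : nat) (X V : 'M[R]_(n, k)).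
Hypothesis XX : X^T *m X = 1%:M.
Hypothesis XV : X^T *m V + V^T *m X = 0.
Hypotheses (k0 : (0 < k)%N) (n0 : (0 < n)%N).

(** 264 = 8 * 33: the error in |V|^2 [M] caused by the angular velocity, with weight [g], then takes
    half of the relaxation that [z] provides for it. 1584 = 6 * 264: the terms in |V|^2 brought by
    [g] and [z] take less than half of the drop |V|^2 / d, and the other half is the final gain n /
    (528 k). *)
Let d : R := 264 * k%:R / n%:R.
Let g : R := n%:R / (1584 * k%:R ^+ 2).
Let z : R := g / k%:R.

Let dp : 0 < d.
Proof.
apply: divr_gt0; last by rewrite ltr0n.
by apply: mulr_gt0; rewrite ltr0n.
Qed.

Let g0 : 0 <= g.
Proof.
by apply: divr_ge0 (ler0n _ _) _; apply: mulr_ge0 (ler0n _ _) (sqr_ge0 _).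
Qed.

Let z0 : 0 <= z. Proof. exact: divr_ge0 g0 (ler0n _ _). Qed.

(** Rows of norm at most 1 bound the added part by 3 g |V|^2 with g <= n / 1584, and n >= 2 leaves
    enough room. *)
Lemma lyap_le (kn : (k < n)%N) : lyap g z X V <= n%:R * sqnorm V.
Proof.
have k1 : 1 <= k%:R :> R by rewrite ler1n.
have n2 : 2 <= n%:R :> R by rewrite ler_nat (leq_ltn_trans k0).
have kp : 0 < k%:R :> R by lra.
have gn : g <= n%:R / 1584.
  rewrite /g invfM mulrA; apply: ler_piMr.
    exact: divr_ge0 (ler0n _ _) (ler0n _ _).
  by rewrite invf_le1 ?exprn_ege1 ?exprn_gt0.
have N0 := sqnorm_ge0 V.
have w2 : wenergy X V <= 2 * sqnorm V.
  have := rowprod_le_sqnorm XX V; have := rowprod_le_sqnorm XX (X *m V^T).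
  rewrite sqnorm_mulmx_tr// /wenergy; lra.
have m2 : rowprod X X <= k%:R.
  by rewrite -(sqnorm_isom XX); exact: rowprod_le_sqnorm.
have gw := ler_wpM2l g0 w2.
have zk : z * k%:R = g by rewrite /z divfK// gt_eqF.
have zm : z * (sqnorm V * rowprod X X) <= g * sqnorm V.
  by rewrite -zk mulrA (mulrAC z k%:R); apply: ler_wpM2l m2; exact: mulr_ge0.
rewrite /lyap.
have gN := ler_wpM2r N0 gn.
have : 0 <= (n%:R - 2) * sqnorm V by rewrite mulr_ge0// subr_ge0.
lra.
Qed.

Lemma sqnorm_le_lyap : sqnorm V <= lyap g z X V.
Proof.
rewrite /lyap -addrA lerDl; apply: addr_ge0; apply: mulr_ge0 => //.
  by apply: addr_ge0; exact: rowprod_ge0.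
by apply: mulr_ge0; [exact: sqnorm_ge0|exact: rowprod_ge0].
Qed.

(** Convexity: the inverse lies above its tangent at [q = 0]. It makes the drop of |V|^2 affine in
    [q], so that it can be summed over the pairs. *)
Lemma inv_le_tangent (q : R) : 0 <= q -> d^-1 - q / d ^+ 2 <= (q + d)^-1.
Proof.
move=> q0.
rewrite -subr_ge0 [leRHS](_ : _ = q ^+ 2 / (d ^+ 2 * (q + d))).
  apply: divr_ge0; first exact: sqr_ge0.
  exact: mulr_ge0 (sqr_ge0 _) (addr_ge0 q0 (ltW dp)).
by field; rewrite !gt_eqF// ltr_wpDl.
Qed.

(** The two angles stand for the mean over the circle, hence the factor 2; dividing by the number of
    pairs gives the contraction factor [rate]. *)
Lemma lyap_contraction (c s c' s' : R) :
  c ^+ 2 + s ^+ 2 = 1 -> c' ^+ 2 = 2^-1 - c * s -> s' ^+ 2 = 2^-1 + c * s ->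
  c' * s' = c ^+ 2 - 2^-1 ->
  pairsum (fun i l =>
    lyap g z (givens i l c s *m X) (givens i l c s *m damped d X V i l) +
    lyap g z (givens i l c' s' *m X) (givens i l c' s' *m damped d X V i l))
  <= 2 * (pairsum (fun _ _ : 'I_n => 1) - n%:R / (528 * k%:R)) * lyap g z X V.
Proof.
move=> cs c2 s2 cs2.
have cs' : c' ^+ 2 + s' ^+ 2 = 1 by rewrite c2 s2; lra.
have k1 : 1 <= k%:R :> R by rewrite ler1n.
have kp : 0 < k%:R :> R by lra.
have np : 0 < n%:R :> R by rewrite ltr0n.
pose F m (Q : 'M[R]_(n, m)) i l := rowprod X Q
     - 4^-1 * (sqn X i - sqn X l) * (sqn Q i - sqn Q l)
     + rdot X X i l * rdot Q Q i l.
set N := sqnorm V; set M := rowprod X X.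
have N0 : 0 <= N := sqnorm_ge0 V.
have M0 : 0 <= M := rowprod_ge0 X X.
(* Bound for half of the sum of the two angles: a combination of functions of the pair whose sums
   are all estimated above. *)
pose B i l := N - (d^-1 * tang X V i l ^+ 2
    - d ^- 2 * (tang X V i l ^+ 2 * (sqn X i + sqn X l)))
  + g * (F _ V i l + F _ (X *m V^T) i l
     + 32^-1 * ((sqn X i + sqn X l) * (sqn V i + sqn V l) *+ 2
                + (wrow X V i + wrow X V l))
     + 33 * ((8 * d)^-1 * (tang X V i l ^+ 2 * (sqn X i + sqn X l))
         + (2 * d)^-1 * M * tang X V i l ^+ 2))
  + z * (N * F _ X i l).
apply: (@le_trans _ _ (2 * pairsum B)).
  rewrite -pairsumZ; apply: le_pairsum => i l il.
  have h1 := lyap_step_le V il dp XX cs g0 z0.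
  have h2 := lyap_step_le V il dp XX cs' g0 z0.
  have A2 := ler_wpM2l (sqr_ge0 (tang X V i l))
    (inv_le_tangent (addr_ge0 (sqn_ge0 X i) (sqn_ge0 X l))).
  have eV := rowprod_rot_avg X V il cs c2 s2 cs2.
  have eX := rowprod_rot_avg X X il cs c2 s2 cs2.
  have eY := rowprod_rot_avg X (X *m V^T) il cs c2 s2 cs2.
  rewrite -/(F _ _ _ _) in eV; rewrite -/(F _ _ _ _) in eX.
  rewrite -/(F _ _ _ _) in eY.
  have gV := congr1 (fun t => g * t) eV; have gY := congr1 (fun t => g * t) eY.
  have zX := congr1 (fun t => z * (N * t)) eX.
  move: h1 h2 A2 gV gY zX; rewrite -/M -/N /B.
  move: (lyap _ _ _ _) (lyap _ _ _ _) => L1 L2.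
  move: (F _ _ _ _) (F _ _ _ _) (F _ _ _ _) => F1 F2 F3.
  move: (rowprod _ _) (rowprod _ _) (rowprod _ _) => r1 r2 r3.
  move: (rowprod _ _) (rowprod _ _) (rowprod _ _) => r4 r5 r6.
  rewrite !invfM.
  move: (_^-1) (d^-1) (tang X V i l ^+ 2) (sqn X i + sqn X l) => e1 e2 A q.
  move: (sqn V i + sqn V l) (wrow X V i + wrow X V l) => v w; lra.
have -> : pairsum B = pairsum (fun _ _ : 'I_n => 1) * N
  - (d^-1 * pairsum (fun i l => tang X V i l ^+ 2)
     - d ^- 2 * pairsum (fun i l => tang X V i l ^+ 2 * (sqn X i + sqn X l)))
  + g * (pairsum (F _ V) + pairsum (F _ (X *m V^T))
     + 32^-1 * (2 * pairsum (fun i l => (sqn X i + sqn X l) * (sqn V i + sqn V l))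
                + pairsum (fun i l => wrow X V i + wrow X V l))
     + 33 * ((8 * d)^-1
               * pairsum (fun i l => tang X V i l ^+ 2 * (sqn X i + sqn X l))
         + (2 * d)^-1 * M * pairsum (fun i l => tang X V i l ^+ 2)))
  + z * N * pairsum (F _ X).
  transitivity (pairsum (fun i l => N * 1 + (- d^-1) * tang X V i l ^+ 2
    + d ^- 2 * (tang X V i l ^+ 2 * (sqn X i + sqn X l))
    + g * F _ V i l + g * F _ (X *m V^T) i l
    + (g * 32^-1 * 2) * ((sqn X i + sqn X l) * (sqn V i + sqn V l))
    + (g * 32^-1) * (wrow X V i + wrow X V l)
    + (g * 33 * (8 * d)^-1) * (tang X V i l ^+ 2 * (sqn X i + sqn X l))
    + (g * 33 * ((2 * d)^-1 * M)) * tang X V i l ^+ 2 + (z * N) * F _ X i l)).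
    by apply: eq_bigr => p _; rewrite /B; ring.
  set f1 := pairsum (F _ V); set f2 := pairsum (F _ X).
  set f3 := pairsum (F _ (X *m V^T)).
  set f4 := pairsum (fun i l => wrow _ _ i + _).
  rewrite !pairsumD !pairsumZ -/f1 -/f2 -/f3 -/f4; by ring.
have P1 := sum_tang2 XX XV; have P2 := sum_tang2_q_le V XX.
have P3 := sum_q_sqn_le V XX; have P4 := sum_wrow_le X V.
have P5 := sum_rowprod_rot_le XX V k0; have P6 := sum_rowprod_rot_le XX (X *m V^T) k0.
have P7 := sum_rowprod_rot_le XX X k0.
have S0 := sqnorm_ge0 (X^T *m V); have S1 := sqnorm_tr_isom_le V XX.
rewrite -/(F _ V) -/N in P5; rewrite -/(F _ (X *m V^T)) sqnorm_mulmx_tr// -/N in P6.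
rewrite -/(F _ X) (sqnorm_isom XX) -/M in P7; rewrite -/N in P1 P3 S1.
pose W := wenergy X V; rewrite -/W in P2.
have W0 : 0 <= W by rewrite addr_ge0 ?rowprod_ge0.
have PA : N <= pairsum (fun i l => tang X V i l ^+ 2) <= 2 * N by rewrite P1; lra.
have {P5 P6} P5 : pairsum (F _ V) + pairsum (F _ (X *m V^T)) <=
  (pairsum (fun _ _ : 'I_n => 1) - n%:R / 4) * W + 3 / 2 * k%:R * N.
  by rewrite /W /wenergy; lra.
have {P3 P4} P3 :
    2 * pairsum (fun i l => (sqn X i + sqn X l) * (sqn V i + sqn V l))
    + pairsum (fun i l => wrow X V i + wrow X V l) <= 2 * (n%:R * W + k%:R * N).
  have := mulr_ge0 (ltW np) (rowprod_ge0 X (X *m V^T)).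
  by rewrite /W /wenergy; lra.
rewrite /lyap -/N -/W -/M.
have d8 : 0 <= (8 * d)^-1 by rewrite invr_ge0 mulr_ge0 ?ltW.
have d2 : 0 <= (2 * d)^-1 by rewrite invr_ge0 mulr_ge0 ?ltW.
have dd : 0 <= d ^- 2 by rewrite invr_ge0 sqr_ge0.
have d1 : 0 <= d^-1 by rewrite invr_ge0 ltW.
case/andP: PA => PA1 PA2.
have Q1 := ler_wpM2l d1 PA1; have Q2 := ler_wpM2l dd P2.
have Q3 := ler_wpM2l d8 P2; have Q4 := ler_wpM2l (mulr_ge0 d2 M0) PA2.
have G1 := ler_wpM2l g0 P5; have G2 := ler_wpM2l g0 P3.
have G3 := ler_wpM2l g0 Q3; have G4 := ler_wpM2l g0 Q4.
have Z1 := ler_wpM2l (mulr_ge0 z0 N0) P7.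
move: Q1 Q2 G1 G2 G3 G4 Z1.
move: (pairsum (F _ V)) (pairsum (F _ X)) (pairsum (F _ (X *m V^T))) => f1 f2 f3.
move: (pairsum _) (pairsum _) => T1 T2.
move: (pairsum _) (pairsum _) (pairsum _) => T3 T4 C.
(* In terms of [rho] all constants are monomials, and [rho <= n] compares the gain with the
   relaxation of the row sums; what is left is linear. *)
pose rho : R := n%:R / k%:R.
have rn : rho <= n%:R by rewrite ler_pdivrMr// ler_peMr// ltW.
have knz : k%:R != 0 :> R by rewrite gt_eqF.
have nnz : n%:R != 0 :> R by rewrite gt_eqF.
have -> : d^-1 = rho / 264 by rewrite /d /rho; field; rewrite knz nnz.
have -> : d ^- 2 = (rho / 264) ^+ 2 by rewrite /d /rho; field; rewrite knz nnz.
have -> : (8 * d)^-1 = rho / 2112 by rewrite /d /rho; field; rewrite knz nnz.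
have -> : (2 * d)^-1 = rho / 528 by rewrite /d /rho; field; rewrite knz nnz.
have -> : n%:R / (528 * k%:R) = rho / 528 by rewrite /rho; field; rewrite knz.
have a1 : g * (k%:R * N) = rho * N / 1584 by rewrite /g /rho; field.
have a2 : g * (n%:R * W) = rho ^+ 2 * W / 1584 by rewrite /g /rho; field.
have a3 : z * N * (n%:R * M) = g * rho * N * M by rewrite /z /g /rho; field.
have a4 : z * N * (k%:R * k%:R) = rho * N / 1584 by rewrite /z /g /rho; field.
have a5 := ler_wpM2r W0 (ler_wpM2l g0 rn).
have a6 := ler_wpM2r M0 (ler_wpM2l (mulr_ge0 z0 N0) rn).
have rho0 : 0 <= rho by rewrite divr_ge0 ?ltW.
have a7 := mulr_ge0 rho0 N0.
have a8 := mulr_ge0 (sqr_ge0 rho) W0.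
have a9 := mulr_ge0 (mulr_ge0 (mulr_ge0 g0 rho0) N0) M0.
lra.
Qed.

End lyapunov.

(** * Integration lemmas *)

Section uniform_nat.
Context (R : realType) (m : nat).

(** Uniform law on 0, ..., m, from which the index of the random pair is drawn. *)
Definition uniform_nat : set nat -> \bar R :=
  mscale (m.+1%:R^-1)%:nng (msum (fun i : nat => \d_i) m.+1).

HB.instance Definition _ := Measure.on uniform_nat.

Let uniform_natT : uniform_nat [set: nat] = 1%E.
Proof.
rewrite /uniform_nat /mscale/= /msum.
rewrite (eq_bigr (fun=> 1%:E)) => [|i _]; last exact: diracT.
by rewrite sumEFin sumr_const card_ord -EFinM mulVf// pnatr_eq0.
Qed.

HB.instance Definition _ :=
  @Measure_isProbability.Build _ _ R uniform_nat uniform_natT.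

Lemma integral_uniform_nat (f : nat -> \bar R) : (forall i, 0 <= f i)%E ->
  (\int[uniform_nat]_i f i = (m.+1%:R^-1)%:E * \sum_(i < m.+1) f i)%E.
Proof.
move=> f0; rewrite ge0_integral_mscale//= ge0_integral_measure_sum//.
by congr (_ * _)%E; apply: eq_bigr => i _; rewrite integral_dirac//= diracT mul1e.
Qed.

End uniform_nat.

(** * Integrals of functions that need not be measurable *)

Section lower_integral.
Context d (T : measurableType d) (R : realType).
Variable mu : {measure set T -> \bar R}.
Local Open Scope ereal_scope.
Import HBNNSimple.

(* The integral of a nonnegative function is a supremum over the simple
   functions below it, whether or not the function is measurable. *)
Lemma integral_le_nnsfun (f : T -> \bar R) (c : \bar R) :
  (forall x, 0 <= f x) ->
  (forall g : {nnsfun T >-> R}, (forall x, (g x)%:E <= f x) ->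
    \int[mu]_x (g x)%:E <= c) ->
  \int[mu]_x f x <= c.
Proof.
move=> f0 fc; rewrite ge0_integralTE//; apply: ge_ereal_sup => _ [g /= gf <-].
by rewrite -integralT_nnsfun; exact: fc.
Qed.

End lower_integral.

(** * Invariance of the uniform angle under shifts *)

Section periodic.
Context (R : realType).
Local Notation mu := (@lebesgue_measure R).
Local Open Scope ereal_scope.

Lemma lebesgue_measure_shift (h : R) (A : set R) : measurable A ->
  pushforward mu (fun x : R => (x + h)%R : measurableTypeR R) A = mu A.
Proof.
move=> mA.
have mh : measurable_fun [set: R] (fun x : R => (x + h)%R : measurableTypeR R).
  exact: measurable_funD.
apply/esym/lebesgue_measure_unique => //= _ [[a b]] _ <-.
rewrite /pushforward.
have -> : (fun x : R => (x + h)%R) @^-1` `]a, b] = `](a - h)%R, (b - h)%R]%classic.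
  by apply/seteqP; split => x; rewrite /= !in_itv/= ltrBlDr lerBrDr.
rewrite !lebesgue_measure_itv/= !lte_fin ltrD2r; case: ifP => // _.
by rewrite -!EFinB; congr (_%:E); ring.
Qed.

Lemma integral_shift (h a b : R) (f : R -> \bar R) :
  measurable_fun setT f -> (forall x, 0 <= f x) ->
  \int[mu]_(x in `[a, b[) f (x + h)%R = \int[mu]_(x in `[(a + h)%R, (b + h)%R[) f x.
Proof.
move=> mf f0.
have mh : measurable_fun [set: R] (fun x : R => (x + h)%R : measurableTypeR R).
  exact: measurable_funD.
transitivity (\int[pushforward mu (fun x : R => (x + h)%R : measurableTypeR R)]_(x in
    `[(a + h)%R, (b + h)%R[) f x); last first.
  by apply: eq_measure_integral => //= A mA _; exact: lebesgue_measure_shift.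
rewrite ge0_integral_pushforward//; last exact: measurable_funS mf.
congr (integral _ _ _).
by apply/seteqP; split => x; rewrite /= !in_itv/= lerD2r ltrD2r.
Qed.

Lemma integral_split (a b c : R) (f : R -> \bar R) : (a <= b)%R -> (b <= c)%R ->
  measurable_fun setT f -> (forall x, 0 <= f x) ->
  \int[mu]_(x in `[a, c[) f x =
  \int[mu]_(x in `[a, b[) f x + \int[mu]_(x in `[b, c[) f x.
Proof.
move=> ab bc mf f0; rewrite -ge0_integral_setU//=.
- congr (integral _ _ _); apply/seteqP; split => x; rewrite /= !in_itv/=.
    by move=> /andP[ax xc]; have [xb|xb] := ltP x b; [left|right]; rewrite ?ax ?xb.
  by move=> [/andP[ax xb]|/andP[bx xc]];
    rewrite ?ax ?xc ?(le_trans ab bx) ?(lt_le_trans xb bc).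
- exact: measurable_funS mf.
- apply/disj_setPS => x; rewrite /= !in_itv/= => -[/andP[_ xb] /andP[bx _]].
  by move: (lt_le_trans xb bx); rewrite ltxx.
Qed.

Lemma integral_periodic (p : R) (f : R -> \bar R) : (0 < p)%R ->
  measurable_fun setT f -> (forall x, 0 <= f x) -> (forall x, f (x + p)%R = f x) ->
  forall h, \int[mu]_(x in `[0%R, p[) f (x + h)%R = \int[mu]_(x in `[0%R, p[) f x.
Proof.
move=> p0 mf f0 fp h.
have fz (z : int) x : f (x + p *~ z)%R = f x.
  have fn (m : nat) y : f (y + p *+ m)%R = f y.
    elim: m y => [|m IH] y; first by rewrite mulr0n addr0.
    by rewrite mulrSr addrA fp IH.
  case: z => m; first by rewrite -pmulrn fn.
  by rewrite NegzE mulrNz -pmulrn -(fn m.+1) subrK.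
(* The multiple [a] of the period satisfies a <= h <= b = a + p. The window from [h] to [p + h] is
   cut at [b], its right part moves back by one period, and the pieces reassemble into the window
   from [a] to [b]. *)
pose z := Num.floor (h / p)%R; pose a := (p *~ z)%R; pose b := (a + p)%R.
have fa x : f (x + a)%R = f x by exact: fz.
have az : a = (z%:~R * p)%R by rewrite /a mulrzl.
have ah : (a <= h)%R by rewrite az -ler_pdivlMr// ge_floor.
have hb : (h <= b)%R.
  rewrite /b az -[X in (_ + X)%R]mul1r -mulrDl -ler_pdivrMr//.
  by have := floorD1_gt (h / p)%R; rewrite intrD => /ltW.
rewrite integral_shift// add0r.
have hp : (b <= p + h)%R by rewrite /b addrC lerD2l.
rewrite (integral_split hb hp)//.
have -> : \int[mu]_(x in `[b, (p + h)%R[) f x = \int[mu]_(x in `[a, h[) f x.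
  under [RHS]eq_integral do rewrite -fp.
  by rewrite integral_shift// -/b (addrC h).
rewrite addeC -(integral_split ah hb)//.
have -> : b = (p + a)%R by rewrite addrC.
rewrite -[X in `[X, _[%classic](add0r a) -integral_shift//.
by apply: eq_integral => x _; rewrite fa.
Qed.

(** This lets an angle chosen from the past be added to the uniform angle without changing any
    law. *)
Lemma integral_uniform_shift (f : R -> \bar R) (h : R) :
  measurable_fun setT f -> (forall x, 0 <= f x) ->
  (forall x, f (x + 2 * pi)%R = f x) ->
  \int[uniform_prob (@twopi_gt0 R)]_x f (x + h)%R =
  \int[uniform_prob (@twopi_gt0 R)]_x f x.
Proof.
move=> mf f0 fp.
have mfh : measurable_fun [set: R] (fun x : R => f (x + h)%R).
  by apply: measurableT_comp => //; exact: measurable_funD.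
rewrite !integral_uniform//.
rewrite -!integral_itv_bndo_bndc; last 2 first.
- exact: measurable_funS mf.
- exact: measurable_funS mfh.
by rewrite integral_periodic// twopi_gt0.
Qed.

End periodic.

(** * Primitives of bounded functions *)

Section primitive.
Context (R : realType).
Local Notation mu := (@lebesgue_measure R).

(** The half-line avoids a case distinction on the sign of [t]; it is applied to functions that
    vanish outside [0, 1]. *)
Definition primitive (f : R -> R) (t : R) : R := \int[mu]_(x in `]-oo, t]) f x.

Section one.
Variables (f : R -> R) (B : R).
Hypotheses (mf : measurable_fun [set: R] f) (fB : forall x, `|f x| <= B).
Hypothesis f01 : forall x, x \notin `[0, 1] -> f x = 0.

Lemma integrable_bounded_supp (D : set R) : measurable D ->
  mu.-integrable D (EFin \o f).
Proof.
move=> mD; apply: (@integrableS _ _ _ _ setT) => //.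
have : mu.-integrable setT ((EFin \o f) \_ `[0%R, 1%R]).
  apply/integrable_restrict => //; rewrite setTI.
  apply: measurable_bounded_integrable => //.
  - by rewrite /= lebesgue_measure_itv/= lte_fin ltr01 -EFinB ltry.
  - exact: measurable_funS mf.
  - exists B; split => [|M BM x _]; first exact: num_real.
    by rewrite /= (le_trans (fB x))// ltW.
apply: eq_integrable => // x _; rewrite patchE; case: ifPn => //=.
by move=> x01; rewrite f01//; apply/negP => xx; move: x01; rewrite notin_setE.
Qed.

Lemma primitive_lipschitz (s t : R) : `|primitive f t - primitive f s| <= B * `|t - s|.
Proof.
wlog st : s t / s <= t.
  move=> H; have [|/ltW] := leP s t; first exact: H.
  by move=> /H; rewrite distrC (distrC s).
rewrite /primitive (@Rintegral_itvB _ _ -oo%O (BRight t)) ?bnd_simp//; last first.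
  exact: integrable_bounded_supp.
apply: (le_trans (le_normr_Rintegral _ _)) => //; first exact: integrable_bounded_supp.
apply: (@le_trans _ _ (\int[mu]_(x in `]s, t]) B)).
  have iB : mu.-integrable `]s, t] (EFin \o cst B).
    apply: measurable_bounded_integrable => //; last exact: bounded_cst.
    by rewrite /= lebesgue_measure_itv/=; case: ifP => // _; rewrite -EFinB ltry.
  apply: le_Rintegral => //.
  exact/integrable_norm/integrable_bounded_supp.
rewrite Rintegral_cst//= lebesgue_measure_itv/= lte_fin.
case: ifPn => [_|]; first by rewrite -EFinB/= ger0_norm// subr_ge0.
by rewrite -leNgt => ts; rewrite /= (le_anti (introT andP (conj st ts))) subrr normr0.
Qed.

Lemma continuous_primitive : continuous (primitive f).
Proof.
have B0 : 0 <= B by exact: le_trans (fB 0).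
move=> t; apply/cvgrPdist_lt => e e0; near=> s.
apply: (le_lt_trans (primitive_lipschitz _ _)).
apply: (@le_lt_trans _ _ ((B + 1) * `|t - s|)).
  by rewrite ler_wpM2r// lerDl.
rewrite -ltr_pdivlMl ?ltr_wpDl//.
near: s; apply/nbhs_ballP; exists ((B + 1)^-1 * e) => //=.
by apply: mulr_gt0 => //; rewrite invr_gt0 ltr_wpDl.
Unshelve. all: by end_near. Qed.

Lemma is_derive_primitive t : {for t, continuous f} ->
  is_derive t 1 (primitive f) (f t).
Proof.
move=> ft; have t1 : t < t + 1 by rewrite ltrDl.
have [dp <-] := @continuous_FTC1 R f -oo%O t (t + 1) t1
  (integrable_bounded_supp (measurable_itv _)) (ltNyr _) ft.
by rewrite derive1E; exact: derivableP.
Qed.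

End one.

(** With the indicator of [r <= z.2] the domain no longer depends on [z], and Tonelli's theorem
    applies to the positive and the negative part. *)
Lemma measurable_primitive d (T : measurableType d) (f : T * R -> R) :
  measurable_fun [set: T * R] f ->
  measurable_fun [set: T * R] (fun z => primitive (fun r => f (z.1, r)) z.2).
Proof.
move=> mf.
have mg (g : T * R -> \bar R) : measurable_fun setT g -> (forall z, 0 <= g z)%E ->
    measurable_fun [set: T * R]
      (fun z => \int[mu]_(r in `]-oo, z.2]) g (z.1, r))%E.
  move=> mg g0.
  have -> : (fun z : T * R => \int[mu]_(r in `]-oo, z.2]) g (z.1, r))%E =
      (fun z : T * R => \int[mu]_r
        (g (z.1, r) * ((0 <= z.2 - r)%R : nat)%:R%:E))%E.
    apply/funext => z; rewrite integral_mkcond; apply: eq_integral => r _.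
    rewrite patchE subr_ge0; case: ifPn.
      by rewrite inE/= in_itv/= => ->; rewrite mule1.
    by rewrite notin_setE/= in_itv/= => /negP/negbTE ->; rewrite mule0.
  apply: (@measurable_fun_fubini_tonelli_F _ _ _ _ _ mu (fun u : (T * R) * R =>
    g (u.1.1, u.2) * ((0 <= u.1.2 - u.2)%R : nat)%:R%:E)%E) => //=.
    apply: emeasurable_funM.
      apply: (measurableT_comp mg); apply: measurable_fun_pair => //.
      exact: (measurableT_comp measurable_fst measurable_fst).
    apply/measurable_EFinP.
    apply: (@measurableT_comp _ _ _ _ _ _ (fun b : bool => (b : nat)%:R : R)) => //.
    apply: measurable_fun_ler => //; apply: measurable_funB => //.
    exact: (measurableT_comp measurable_snd measurable_fst).
  by move=> u; rewrite mule_ge0.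
rewrite /primitive /Rintegral.
apply: (measurableT_comp (fine_measurable measurableT)).
under eq_fun do rewrite integralE.
have mE : measurable_fun setT (fun z : T * R => (f z)%:E) by exact/measurable_EFinP.
apply: emeasurable_funB.
- have := mg _ (measurable_funepos mE) (funepos_ge0 _).
  by apply: eq_measurable_fun => z _; apply: eq_integral => r _; rewrite !funeposE.
- have := mg _ (measurable_funeneg mE) (funeneg_ge0 _).
  by apply: eq_measurable_fun => z _; apply: eq_integral => r _; rewrite !funenegE.
Qed.

End primitive.

(** * Curves moved by random rotations *)

Section curves.
Context (R : realType) (n k : nat).
Local Notation M := 'M[R]_(n, k).

Lemma rotationE (i l : 'I_n) (th : R) : rotation i l th = givens i l (cos th) (sin th).
Proof. by []. Qed.

Lemma continuous_sumr (I : finType) (f : I -> R -> R) :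
  (forall i, continuous (f i)) -> continuous (fun t => \sum_i f i t).
Proof.
by move=> cf; apply: continuous_big => [|i _]; [exact: add_continuous|exact: cf].
Qed.

Lemma continuous_rdot (P Q : R -> M) i l :
  (forall i j, continuous (fun t => P t i j)) ->
  (forall i j, continuous (fun t => Q t i j)) ->
  continuous (fun t => rdot (P t) (Q t) i l).
Proof.
move=> cP cQ; apply: continuous_sumr => j t.
by apply: cvgM; [exact: cP|exact: cQ].
Qed.

Lemma continuous_angvel d i l (G W : R -> M) : 0 < d ->
  (forall i j, continuous (fun t => G t i j)) ->
  (forall i j, continuous (fun t => W t i j)) ->
  continuous (fun t => angvel d (G t) (W t) i l).
Proof.
move=> d0 cG cW t; rewrite /angvel; apply: cvgM.
  by apply: cvgN; apply: cvgB; exact: continuous_rdot.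
apply: cvgV.
  by rewrite gt_eqF// ltr_wpDl// addr_ge0 ?sqn_ge0.
apply: cvgD; last exact: cvg_cst.
by apply: cvgD; exact: continuous_rdot.
Qed.

Lemma continuous_damped d (i l : 'I_n) (G W : R -> M) : i != l -> 0 < d ->
  (forall i j, continuous (fun t => G t i j)) ->
  (forall i j, continuous (fun t => W t i j)) ->
  forall m j, continuous (fun t => damped d (G t) (W t) i l m j).
Proof.
move=> il d0 cG cW m j.
rewrite (_ : (fun t => _) = (fun t => W t m j + angvel d (G t) (W t) i l *
  (if m == i then G t l j else if m == l then - G t i j else 0))); last first.
  by apply/funext => t; rewrite mxE [X in _ + X]mxE skew_rowE.
move=> t; apply: cvgD; first exact: cW.
apply: cvgM; first exact: continuous_angvel.
case: ifP => _; first exact: cG.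
by case: ifP => _; [apply: cvgN; exact: cG | exact: cvg_cst].
Qed.

Lemma continuous_rotation (i l : 'I_n) (f : R -> R) (G : R -> M) : i != l ->
  continuous f -> (forall i j, continuous (fun t => G t i j)) ->
  forall m j, continuous (fun t => (rotation i l (f t) *m G t) m j).
Proof.
move=> il cf cG m j.
rewrite (_ : (fun t => _) = (fun t => if m == i
  then cos (f t) * G t i j + sin (f t) * G t l j else if m == l
  then - sin (f t) * G t i j + cos (f t) * G t l j else G t m j)); last first.
  by apply/funext => t; rewrite rotationE rot_rowE.
have cc : continuous (fun t => cos (f t)).
  by move=> t; apply: continuous_comp; [exact: cf|exact: continuous_cos].
have ss : continuous (fun t => sin (f t)).
  by move=> t; apply: continuous_comp; [exact: cf|exact: continuous_sin].
move=> t; case: (m == i); last case: (m == l).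
- apply: cvgD; apply: cvgM; by [exact: cc|exact: ss|exact: cG].
- apply: cvgD; apply: cvgM; try exact: cG; last exact: cc.
  by apply: cvgN; exact: ss.
- exact: cG.
Qed.

(** The product rule, as the derivative of a plane rotation in its angle is the rotation times
    [skew i l]. *)
Lemma is_derive_rotation (i l : 'I_n) (f : R -> R) (G : R -> M) (t sg : R) (V : M) :
  i != l -> is_derive t 1 f sg ->
  (forall i j, is_derive t 1 (fun u => G u i j) (V i j)) ->
  forall m j, is_derive t 1 (fun u => (rotation i l (f u) *m G u) m j)
    ((rotation i l (f t) *m (V + sg *: (skew i l *m G t))) m j).
Proof.
move=> il df dG m j.
rewrite (_ : (fun u => _) = (fun u => if m == i
  then cos (f u) * G u i j + sin (f u) * G u l j else if m == l
  then - sin (f u) * G u i j + cos (f u) * G u l j else G u m j)); last first.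
  by apply/funext => u; rewrite rotationE rot_rowE.
have VE a b : (V + sg *: (skew i l *m G t)) a b = V a b + sg * (if a == i
    then G t l b else if a == l then - G t i b else 0).
  by rewrite mxE [X in _ + X]mxE skew_rowE.
rewrite rotationE rot_rowE// !VE !eqxx (eq_sym l i) (negbTE il).
have dc : is_derive t 1 (fun u => cos (f u)) (- sin (f t) * sg).
  exact: is_derive1_comp.
have ds : is_derive t 1 (fun u => sin (f u)) (cos (f t) * sg).
  exact: is_derive1_comp.
case: (m == i) => /=; last case: (m == l) => /=.
- refine (is_derive_eq (is_deriveD (is_deriveM dc (dG i j)) (is_deriveM ds (dG l j))) _).
  by rewrite /GRing.scale/=; ring.
- refine (is_derive_eq (is_deriveD (is_deriveM (is_deriveN ds) (dG i j))
    (is_deriveM dc (dG l j))) _).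
  by rewrite /GRing.scale/= ?fctE; ring.
- by rewrite mulr0 addr0; exact: dG.
Qed.

Variable s : seq R.

Definition in_piece m t := t \in `]nth 1 (0 :: s) m, nth 1 (0 :: s) m.+1[.

Definition regular t := exists2 m, (m < size s)%N & in_piece m t.

(** Position and velocity on the whole line, the velocity being 0 at the break points and outside
    the pieces. One-sided limits are encoded by a globally continuous [W] that agrees with [V] on
    the open piece. *)
Definition curve (G V : R -> M) : Prop :=
  [/\ forall i j, continuous (fun t => G t i j),
      forall t, ~ regular t -> V t = 0,
      forall t, regular t -> forall i j, is_derive t 1 (fun u => G u i j) (V t i j)
    & forall m, (m < size s)%N -> exists2 W : R -> M,
        forall i j, continuous (fun t => W t i j) &
        forall t, in_piece m t -> V t = W t].

Lemma curve_angvel_continuous d i l (G V : R -> M) t : 0 < d ->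
  curve G V -> regular t ->
  {for t, continuous (fun u => angvel d (G u) (V u) i l)}.
Proof.
move=> d0 [cG _ _ cV] [m ms tm].
have [W cW VW] := cV m ms.
have cs : continuous (fun u => angvel d (G u) (W u) i l) by exact: continuous_angvel.
move: (cs t); rewrite /continuous_at -VW//; apply: cvg_trans; apply: near_eq_cvg.
have : \forall u \near t, in_piece m u by exact: near_in_itvoo.
by apply: filterS => u um; rewrite VW.
Qed.

Lemma curve_step d (i l : 'I_n) (th : R) (h : R -> R) (G V : R -> M) :
  i != l -> 0 < d -> curve G V -> continuous h ->
  (forall t, regular t -> is_derive t 1 h (angvel d (G t) (V t) i l)) ->
  curve (fun t => rotation i l (th + h t) *m G t)
        (fun t => rotation i l (th + h t) *m damped d (G t) (V t) i l).
Proof.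
move=> il d0 [cG V0 dG cV] ch dh.
have cth : continuous (fun t => th + h t).
  by move=> t; apply: cvgD; [exact: cvg_cst|exact: ch].
split=> [||t rt|m ms].
- exact: continuous_rotation.
(* Where the velocity vanishes so does the angular velocity, so the convention at irregular points
   survives the step. *)
- move=> t rt; rewrite /damped V0// /angvel /tang /rdot.
  rewrite !big1 => [|j _|j _]; rewrite ?mxE ?mul0r//.
  by rewrite subr0 oppr0 mul0r scale0r addr0 mulmx0.
- apply: (is_derive_rotation (G := G) (f := fun u => th + h u)) => //; last exact: dG.
  refine (is_derive_eq (is_deriveD (is_derive_cst th t 1) (dh t rt)) _).
  by rewrite add0r.
- have [W cW VW] := cV m ms.
  exists (fun t => rotation i l (th + h t) *m damped d (G t) (W t) i l).
    by apply: continuous_rotation => //; exact: continuous_damped.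
  by move=> t tm; rewrite VW.
Qed.

End curves.

(** * Measurability *)

Lemma measurable_fun_natP d1 d2 (X : measurableType d1) (Y : measurableType d2)
    (N : X -> nat) (F : nat -> X -> Y) :
  measurable_fun [set: X] N -> (forall j, measurable_fun [set: X] (F j)) ->
  measurable_fun [set: X] (fun x => F (N x) x).
Proof.
move=> mN mF _ A mA; rewrite setTI.
have -> : (fun x => F (N x) x) @^-1` A =
    \bigcup_j (N @^-1` [set j] `&` F j @^-1` A).
  by apply/seteqP; split => [x /= Ax|x [j _ [/= <-]]//]; exists (N x).
apply: bigcupT_measurable => j; apply: measurableI.
  by rewrite -[X in measurable X]setTI; exact: mN.
by rewrite -[X in measurable X]setTI; exact: mF.
Qed.

Section measurability.
Context (R : realType) (n k : nat).
Local Notation M := 'M[R]_(n, k).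
Context d (T : measurableType d).
Implicit Types G V : T -> M.

Lemma measurable_entry G i j : measurable_fun [set: T] G ->
  measurable_fun [set: T] (fun x => G x i j).
Proof. exact: (measurableT_comp (measurable_coord i j)). Qed.

Lemma measurable_mulmx_tr m (G : T -> 'M[R]_(m, k)) V i l :
  measurable_fun [set: T] G -> measurable_fun [set: T] V ->
  measurable_fun [set: T] (fun x => \sum_j G x i j * V x l j).
Proof.
move=> mG mV; apply: measurable_sum => j; apply: measurable_funM.
  exact: (measurableT_comp (measurable_coord i j)).
exact: measurable_entry.
Qed.

Lemma measurable_rdot G V i l :
  measurable_fun [set: T] G -> measurable_fun [set: T] V ->
  measurable_fun [set: T] (fun x => rdot (G x) (V x) i l).
Proof. exact: measurable_mulmx_tr. Qed.

Lemma measurable_sqnorm G : measurable_fun [set: T] G ->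
  measurable_fun [set: T] (fun x => sqnorm (G x)).
Proof. by move=> mG; apply: measurable_sum => i; exact: measurable_rdot. Qed.

Lemma measurable_angvel e G V i l : 0 < e ->
  measurable_fun [set: T] G -> measurable_fun [set: T] V ->
  measurable_fun [set: T] (fun x => angvel e (G x) (V x) i l).
Proof.
move=> e0 mG mV; rewrite /angvel; apply: measurable_funM.
  by apply: measurableT_comp => //; apply: measurable_funB; exact: measurable_rdot.
(* The absolute value changes nothing here but makes the inverse a continuous function on the whole
   line. *)
rewrite (_ : (fun x => _) =
    (fun x => (`|sqn (G x) i + sqn (G x) l| + e)^-1)); last first.
  by apply/funext => x; rewrite ger0_norm// addr_ge0 ?sqn_ge0.
apply: (@measurableT_comp _ _ _ _ _ _ (fun y : R => (`|y| + e)^-1)).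
  apply: continuous_measurable_fun => y.
  apply: cvgV; first by rewrite gt_eqF// ltr_wpDl.
  by apply: cvgD; [exact: norm_continuous|exact: cvg_cst].
by apply: measurable_funD; exact: measurable_rdot.
Qed.

Lemma measurable_damped e G V (i l : 'I_n) : 0 < e ->
  measurable_fun [set: T] G -> measurable_fun [set: T] V ->
  measurable_fun [set: T] (fun x => damped e (G x) (V x) i l).
Proof.
move=> e0 mG mV; apply: measurable_fun_mx => m j.
rewrite (_ : (fun x => _) = (fun x => V x m j + angvel e (G x) (V x) i l *
  \sum_r skew i l m r * G x r j)); last first.
  by apply/funext => t; rewrite mxE [X in _ + X]mxE [X in _ * X]mxE.
apply: measurable_funD; first exact: measurable_entry.
apply: measurable_funM; first exact: measurable_angvel.
by apply: measurable_sum => r; apply: measurable_funM => //; exact: measurable_entry.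
Qed.

Lemma measurable_rotation_comp (p : 'I_n * 'I_n) (th : T -> R) G :
  measurable_fun [set: T] th -> measurable_fun [set: T] G ->
  measurable_fun [set: T] (fun x => rotation p.1 p.2 (th x) *m G x).
Proof.
move=> mth mG.
apply: (measurableT_comp (measurable_rotation_mul (R := R) (k := k) p)
  (measurable_fun_pair mG mth)).
Qed.

Lemma measurable_lyap g z G V :
  measurable_fun [set: T] G -> measurable_fun [set: T] V ->
  measurable_fun [set: T] (fun x => lyap g z (G x) (V x)).
Proof.
move=> mG mV; rewrite /lyap /wenergy.
have mF m (P : T -> 'M[R]_(n, m)) : measurable_fun [set: T] P ->
    measurable_fun [set: T] (fun x => rowprod (G x) (P x)).
  move=> mP; apply: measurable_sum => i; apply: measurable_funM.
    exact: measurable_rdot.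
  apply: measurable_sum => j; apply: measurable_funM;
    exact: (measurableT_comp (measurable_coord i j)).
have mN := measurable_sqnorm mV.
apply: measurable_funD; first apply: measurable_funD => //.
- apply: measurable_funM => //; apply: measurable_funD; first exact: mF.
  apply: mF; apply: measurable_fun_mx => i j.
  under eq_fun do rewrite -rdotE.
  exact: measurable_rdot.
- by apply: measurable_funM => //; apply: measurable_funM => //; exact: mF.
Qed.

End measurability.

(** * The averaged step *)

Section step.
Context (R : realType) (n k : nat).
Local Notation M := 'M[R]_(n, k).
Local Notation U := (uniform_prob (@twopi_gt0 R)).

Definition step e (p : 'I_n * 'I_n) (th : R) (z : M * M) : M * M :=
  (rotation p.1 p.2 th *m z.1, rotation p.1 p.2 th *m damped e z.1 z.2 p.1 p.2).

(** The Markov operator of the pair of position and velocity, for a uniform angle without the shift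
    [h], which does not affect the mean. *)
Definition step_mean e (F : M * M -> \bar R) (z : M * M) : \bar R :=
  (('C(n, 2)%:R^-1)%:E *
     \sum_(p : 'I_n * 'I_n | (p.1 < p.2)%N) \int[U]_th F (step e p th z))%E.

Lemma measurable_step d (T : measurableType d) e (p : 'I_n * 'I_n) (th : T -> R)
    (G V : T -> M) : 0 < e ->
  measurable_fun [set: T] th -> measurable_fun [set: T] G ->
  measurable_fun [set: T] V ->
  measurable_fun [set: T] (fun x => step e p (th x) (G x, V x)).
Proof.
move=> e0 mth mG mV; rewrite /step/=; apply: measurable_fun_pair.
  exact: measurable_rotation_comp.
by apply: measurable_rotation_comp => //; exact: measurable_damped.
Qed.

Lemma step2pi e p th z : step e p (th + 2 * pi) z = step e p th z.
Proof.
by rewrite /step !rotationE mulr_natl cosD2pi sinD2pi.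
Qed.

Lemma step_mean_indic e (A : set M) z : measurable A ->
  step_mean e (fun y => (\1_A y.1)%:E) z = walk_step z.1 A.
Proof.
move=> mA; rewrite /step_mean /walk_step; congr (_ * _)%E.
apply: eq_bigr => p p12; rewrite /rotation_law /pushforward/=.
rewrite -[RHS]mul1e -[in RHS](setIT (_ @^-1` A)) -integral_indic//; last first.
  by rewrite -[X in measurable X]setTI; exact: measurable_rotation.
by rewrite mul1e.
Qed.

(** Here and in the next two lemmas: the angles [x] and [x + pi / 4] fulfil the relations of
    [lyap_contraction], since doubling turns the offset into a right angle. *)
Lemma cosD_pi4 (x : R) : cos (x + pi / 4) ^+ 2 = 2^-1 - cos x * sin x.
Proof.
have := cos_mulr2n (x + pi / 4).
rewrite (_ : (x + pi / 4) *+ 2 = x *+ 2 + pi / 2); last by field.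
rewrite cosDpihalf sin_mulr2n => h; lra.
Qed.

Lemma sinD_pi4 (x : R) : sin (x + pi / 4) ^+ 2 = 2^-1 + cos x * sin x.
Proof.
have := cos2Dsin2 (x + pi / 4); rewrite cosD_pi4 => h; lra.
Qed.

Lemma cos_sinD_pi4 (x : R) :
  cos (x + pi / 4) * sin (x + pi / 4) = cos x ^+ 2 - 2^-1.
Proof.
have := sin_mulr2n (x + pi / 4).
rewrite (_ : (x + pi / 4) *+ 2 = x *+ 2 + pi / 2); last by field.
rewrite sinDpihalf cos_mulr2n => h; lra.
Qed.

Definition damping : R := 264 * k%:R / n%:R.
Definition weight1 : R := n%:R / (1584 * k%:R ^+ 2).
Definition weight2 : R := weight1 / k%:R.
Definition energy (z : M * M) : R := lyap weight1 weight2 z.1 z.2.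
(** As C(n, 2) = n (n - 1) / 2, this is 1 - 1 / (264 k (n - 1)), hence at most 1 - 1 / (264 n k). *)
Definition rate : R := 1 - n%:R / (528 * k%:R) / 'C(n, 2)%:R.

Hypotheses (k0 : (0 < k)%N) (kn : (k < n)%N).

Lemma damping_gt0 : 0 < damping.
Proof. by rewrite divr_gt0 ?mulr_gt0 ?ltr0n// (leq_ltn_trans _ kn). Qed.

Lemma energy_ge0 z : 0 <= energy z.
Proof.
rewrite /energy; apply: le_trans (sqnorm_le_lyap _ _); exact: sqnorm_ge0.
Qed.

Lemma pairsum1 : pairsum (fun _ _ : 'I_n => 1) = 'C(n, 2)%:R :> R.
Proof. by rewrite /pairsum sumr_const card_pairs. Qed.

Lemma step_mean_energy_le z : z.1^T *m z.1 = 1%:M ->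
  z.1^T *m z.2 + z.2^T *m z.1 = 0 ->
  (step_mean damping (fun y => (energy y)%:E) z <= (rate * energy z)%:E)%E.
Proof.
move=> XX XV.
have n0 : (0 < n)%N by exact: leq_ltn_trans kn.
pose f p th := (energy (step damping p th z))%:E.
have -> : step_mean damping (fun y => (energy y)%:E) z = (('C(n, 2)%:R^-1)%:E *
    \sum_(p : 'I_n * 'I_n | (p.1 < p.2)%N) \int[U]_th f p th)%E by [].
have f0 p th : (0 <= f p th)%E by rewrite lee_fin energy_ge0.
have mf p : measurable_fun [set: R] (f p).
  apply/measurable_EFinP; rewrite /energy.
  have := measurable_step p damping_gt0 (@measurable_id _ R setT)
     (measurable_cst z.1) (measurable_cst z.2).
  rewrite -[(z.1, z.2)]surjective_pairing => ms.
  apply: measurable_lyap; first exact: (measurableT_comp measurable_fst ms).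
  exact: (measurableT_comp measurable_snd ms).
have fp p th : f p (th + 2 * pi) = f p th by rewrite /f step2pi.
pose K := ('C(n, 2)%:R - n%:R / (528 * k%:R)) * energy z.
have fK th : (\sum_(p : 'I_n * 'I_n | (p.1 < p.2)%N)
    (f p th + f p (th + pi / 4)%R) <= (2 * K)%:E)%E.
  rewrite sumEFin lee_fin.
  have := lyap_contraction XX XV k0 n0 (cos2Dsin2 th) (cosD_pi4 th) (sinD_pi4 th)
    (cos_sinD_pi4 th).
  by rewrite pairsum1 -(mulrA 2); exact: id.
have C0 : 0 < 'C(n, 2)%:R :> R by rewrite ltr0n bin_gt0 (leq_ltn_trans k0).
have -> : rate * energy z = 'C(n, 2)%:R^-1 * K.
  by rewrite /K /rate; field; apply/andP; split; rewrite gt_eqF// ltr0n.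
clearbody f K.
have mfh p : measurable_fun [set: R] (fun th : R => f p (th + pi / 4)).
  apply: (measurableT_comp (mf p)); exact: measurable_funD.
(* By shift invariance one of the two copies may be taken at [th + pi / 4]; the integrand is then
   bounded by [fK] at each angle. *)
have K2 : (\sum_(p : 'I_n * 'I_n | (p.1 < p.2)%N) \int[U]_th f p th +
   \sum_(p : 'I_n * 'I_n | (p.1 < p.2)%N) \int[U]_th f p th <= (2 * K)%:E)%E.
  rewrite -big_split/=.
  have -> : (\sum_(p : 'I_n * 'I_n | (p.1 < p.2)%N)
      (\int[U]_th f p th + \int[U]_th f p th) =
    \sum_(p : 'I_n * 'I_n | (p.1 < p.2)%N)
      \int[U]_th (f p th + f p (th + pi / 4)%R))%E.
    apply: eq_bigr => p p12; rewrite [RHS]ge0_integralD//; last 2 first.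
      exact: mf.
      exact: mfh.
    congr (_ + _)%E; rewrite integral_uniform_shift//; exact: mf.
  rewrite -big_filter -ge0_integral_sum//; last 2 first.
    by move=> p; apply: emeasurable_funD; [exact: mf|exact: mfh].
    by move=> p th _; rewrite adde_ge0.
  apply: (@le_trans _ _ (\int[U]_th (2 * K)%:E)%E).
    apply: ge0_le_integral => //.
    - by move=> th _; rewrite sume_ge0// => p _; rewrite adde_ge0.
    - by apply: emeasurable_sum => p; apply: emeasurable_funD; [exact: mf|exact: mfh].
    - by move=> th _; rewrite big_filter.
  by rewrite integral_cst//= probability_setT mule1.
move: K2; set S := (\sum_(_ | _) _)%E => K2.
have S0 : (0 <= S)%E by rewrite sume_ge0// => p _; exact: integral_ge0.
have SK : (S <= K%:E)%E.
  by case: S S0 K2 => [r _||]//; rewrite ?lee_fin; lra.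
by rewrite EFinM; apply: lee_wpmul2l; [rewrite lee_fin invr_ge0 ltW|exact: SK].
Qed.

End step.

(** * The random curve *)

Section coupled_step.
Context (R : realType) (n k : nat).
Local Notation M := 'M[R]_(n, k).
Local Notation U := (uniform_prob (@twopi_gt0 R)).

Definition tangent (z : M * M) : Prop :=
  stiefel z.1 /\ z.1^T *m z.2 + z.2^T *m z.1 = 0.

Lemma tangent_step e (p : 'I_n * 'I_n) th z : (p.1 < p.2)%N -> tangent z -> tangent (step e p th z).
Proof.
move=> p12 [XX XV]; have il : p.1 != p.2 by rewrite -val_eqE/= ltn_eqF.
split; first exact: stiefel_rotation.
rewrite /step/= !trmx_mul !mulmxA.
rewrite -(mulmxA z.1^T) -(mulmxA _ _ (rotation _ _ _)) !rotation_orthogonal// !mulmx1.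
have tE (a : R) (V W : M) : (V + a *: W)^T = V^T + a *: W^T.
  by apply/matrixP => i j; rewrite !mxE.
have JT : skew p.1 p.2 + (skew p.1 p.2)^T = 0 :> 'M[R]_n.
  by apply/matrixP => i j; rewrite !mxE (andbC (j == _)) (andbC (j == p.2)); ring.
rewrite /damped; move: (skew p.1 p.2) JT => J JT.
rewrite tE mulmxDr mulmxDl addrACA XV add0r -scalemxAr -scalemxAl -scalerDr.
by rewrite trmx_mul mulmxA -mulmxDl -mulmxDr JT mulmx0 mul0mx scaler0.
Qed.

Lemma sqnorm_step_le e (p : 'I_n * 'I_n) th (z : M * M) : (p.1 < p.2)%N -> 0 < e ->
  sqnorm (step e p th z).2 <= sqnorm z.2.
Proof.
move=> p12 e0; have il : p.1 != p.2 by rewrite -val_eqE/= ltn_eqF.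
by rewrite /step/= rotationE sqnorm_rot ?cos2Dsin2// sqnorm_damped_leN.
Qed.

(** A bound in terms of the speed only, so that the primitive of the angular velocity along a curve
    is Lipschitz. *)
Lemma angvel_bound e (p : 'I_n * 'I_n) (z : M * M) : 0 < e -> tangent z ->
  `|angvel e z.1 z.2 p.1 p.2| <= (1 + 4 * sqnorm z.2) / e.
Proof.
move=> e0 [XX _]; rewrite /angvel normrM normrN normfV.
set q := sqn z.1 p.1 + sqn z.1 p.2.
have q0 : 0 <= q by rewrite addr_ge0 ?sqn_ge0.
have qe : e <= q + e by rewrite lerDr.
have qe0 : 0 < q + e by exact: lt_le_trans qe.
rewrite (ger0_norm (ltW qe0)) ler_pM ?invr_ge0 ?(ltW qe0)//; last first.
  by rewrite lef_pV2 ?posrE.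
have ab i l : rdot z.2 z.1 i l ^+ 2 <= sqnorm z.2.
  apply: (le_trans (rdot_CS _ _ _ _)); apply: le_trans (sqn_le_sqnorm _ i).
  by rewrite -[leRHS]mulr1 ler_wpM2l ?sqn_ge0 ?sqn_isom_le1.
have := ab p.1 p.2; have := ab p.2 p.1; rewrite /tang.
move: (rdot _ _ _ _) (rdot _ _ _ _) (sqnorm _) => a b N h1 h2.
have h3 := sqr_ge0 (a + b); have h4 := sqr_ge0 (a - b - 1).
have h5 := sqr_ge0 (a - b + 1).
by rewrite ler_norml; apply/andP; split; nra.
Qed.

Hypothesis n1 : (1 < n)%N.

Definition pair0 : 'I_n * 'I_n := (Ordinal (ltnW n1), Ordinal n1).

(** The default is the pair (0, 1), so that every index yields an increasing pair. *)
Definition nth_pair (j : nat) : 'I_n * 'I_n :=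
  nth pair0 (enum [pred p : 'I_n * 'I_n | (p.1 < p.2)%N]) j.

Lemma nth_pair_lt j : ((nth_pair j).1 < (nth_pair j).2)%N.
Proof.
rewrite /nth_pair; set s := enum _; have [js|js] := ltnP j (size s).
  by have := mem_nth pair0 js; rewrite mem_enum.
by rewrite nth_default.
Qed.

Lemma sum_nth_pair (f : 'I_n * 'I_n -> \bar R) :
  (\sum_(j < ('C(n, 2)).-1.+1) f (nth_pair j) =
   \sum_(p : 'I_n * 'I_n | (p.1 < p.2)%N) f p)%E.
Proof.
have -> : ('C(n, 2)).-1.+1 = size (enum [pred p : 'I_n * 'I_n | (p.1 < p.2)%N]).
  by rewrite -cardE card_pairs prednK// bin_gt0.
rewrite -(big_mkord xpredT (fun j => f (nth_pair j))) /nth_pair.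
by rewrite -(big_nth pair0 xpredT f) big_enum.
Qed.

Context d (Omega : measurableType d) (P : probability Omega R).

(** The past, a fresh uniform angle and a fresh pair index; the predecessor appears because
    [uniform_nat] charges one point more than its parameter. *)
Definition noise_prob : probability _ R :=
  [the probability _ R of ((P \x U) \x uniform_nat R ('C(n, 2)).-1)%E].

Lemma integral_noise (f : (Omega * R) * nat -> \bar R) :
  measurable_fun setT f -> (forall z, 0 <= f z)%E ->
  (\int[noise_prob]_w f w =
   \int[P]_o (('C(n, 2)%:R^-1)%:E *
     \sum_(p < ('C(n, 2)).-1.+1) \int[U]_th f (o, th, nat_of_ord p)))%E.
Proof.
move=> mf f0; rewrite /noise_prob fubini_tonelli1//.
have mfj j : measurable_fun setT (fun z => f (z, j)).
  exact: (measurableT_comp mf (pair2_measurable j)).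
have C0 : (0 < 'C(n, 2))%N by rewrite bin_gt0.
under eq_integral do rewrite /fubini_F integral_uniform_nat// prednK//.
have mS : measurable_fun [set: Omega * R] (fun z =>
    (('C(n, 2)%:R^-1)%:E * \sum_(i < 'C(n, 2)) f (z, nat_of_ord i)))%E.
  by apply: measurable_funeM; apply: emeasurable_sum => j; exact: mfj.
have S0 z : (0 <= ('C(n, 2)%:R^-1)%:E * \sum_(i < 'C(n, 2)) f (z, nat_of_ord i))%E.
  by rewrite mule_ge0 ?lee_fin ?invr_ge0// sume_ge0.
rewrite fubini_tonelli1//; apply: eq_integral => o _; rewrite /fubini_F.
have mfo (j : nat) : measurable_fun [set: R] (fun th : R => f (o, th, j)).
  exact: (measurableT_comp (mfj j) (pair1_measurable o)).
rewrite ge0_integralZl//; last 2 first.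
- by apply: emeasurable_sum => j; exact: mfo.
- by move=> th _; rewrite sume_ge0.
rewrite prednK// ge0_integral_sum// => j; exact: mfo.
Qed.

End coupled_step.

(** * Construction of the random curve by induction on the number of steps *)

Section coupled.
Context (R : realType) (n k : nat).
Local Notation M := 'M[R]_(n, k).
Local Notation U := (uniform_prob (@twopi_gt0 R)).
Hypotheses (k0 : (0 < k)%N) (kn : (k < n)%N).

Let n1 : (1 < n)%N. Proof. exact: leq_ltn_trans kn. Qed.
Let e : R := damping R n k.
Let e0 : 0 < e. Proof. exact: damping_gt0. Qed.

Lemma rate_ge0 : 0 <= rate R n k.
Proof.
have C0 : 0 < 'C(n, 2)%:R :> R by rewrite ltr0n bin_gt0.
rewrite /rate subr_ge0 ler_pdivrMr// mul1r.
rewrite ler_pdivrMr ?mulr_gt0 ?ltr0n//.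
have k1 : 1 <= k%:R :> R by rewrite ler1n.
have : n%:R <= 2 * 'C(n, 2)%:R :> R.
  rewrite -natrM ler_nat -mul_bin_diag bin1 leq_pmulr//.
  by rewrite -ltnS prednK// ltnW.
move=> h; apply: (le_trans h); rewrite mulrC ler_pM2l//.
lra.
Qed.

Variables (s : seq R) (Z0 : R -> M * M) (B : R).
Hypothesis s01 : itv_partition 0 1 s.

(** The induction invariant. The probability space is existential because each step adjoins an angle
    and a pair. Laws are prescribed for each single [t], which suffices for the two end points and,
    through the mean energies, for the mean length. *)
Definition coupled (T : nat) : Prop :=
  exists (d : measure_display) (X : measurableType d)
    (P : probability X R) (Z : X * R -> M * M),
  [/\ measurable_fun [set: X * R] Z,
      forall o, curve s (fun t => (Z (o, t)).1) (fun t => (Z (o, t)).2),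
      forall w, tangent (Z w) /\ sqnorm (Z w).2 <= sqnorm (Z0 w.2).2,
      forall t A, measurable A ->
        P [set o | A (Z (o, t)).1] = walk_iter T (Z0 t).1 A &
      forall t, (\int[P]_o (energy (Z (o, t)))%:E
        <= (rate R n k ^+ T * energy (Z0 t))%:E)%E].

Lemma regular01 t : regular s t -> t \in `[0, 1].
Proof.
move=> [m ms]; rewrite /in_piece !in_itv/= => /andP[mt tm].
have h1 := itv_partition_nth_ge (leqW ms) s01.
have h2 := itv_partition_nth_le (ms : (m.+1 < (size s).+1)%N) s01.
rewrite (ltW (le_lt_trans h1 mt))//= (ltW (lt_le_trans tm h2))//.
Qed.

Hypotheses (mZ0 : measurable_fun [set: R] Z0)
  (cZ0 : curve s (fun t => (Z0 t).1) (fun t => (Z0 t).2))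
  (tZ0 : forall t, tangent (Z0 t))
  (BZ0 : forall t, sqnorm (Z0 t).2 <= B).

Lemma measurable_step_mean (F : M * M -> \bar R) :
  measurable_fun setT F -> (forall z, 0 <= F z)%E ->
  measurable_fun setT (step_mean e F).
Proof.
move=> mF F0; apply: measurable_funeM.
rewrite (_ : (fun x => _) = (fun x => \sum_(p : 'I_n * 'I_n)
    if (p.1 < p.2)%N then \int[U]_th F (step e p th x) else 0)%E); last first.
  by apply/funext => x; rewrite big_mkcond.
apply: emeasurable_sum => p; case: (p.1 < p.2)%N => //.
apply: (@measurable_fun_fubini_tonelli_F _ _ _ _ _ U
  (fun u : (M * M) * R => F (step e p u.2 u.1))) => //.
apply: (measurableT_comp mF).
have := measurable_step p e0 (@measurable_snd _ _ (M * M)%type R)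
  (measurableT_comp measurable_fst (@measurable_fst _ _ (M * M)%type R))
  (measurableT_comp measurable_snd (@measurable_fst _ _ (M * M)%type R)).
by apply: eq_measurable_fun => u _ /=; rewrite -surjective_pairing.
Qed.

Lemma coupled0 : coupled 0.
Proof.
exists _, unit, [the probability _ R of \d_tt], (fun w => Z0 w.2); split.
- exact: (measurableT_comp mZ0 measurable_snd).
- by move=> [].
- by move=> w; split.
- by move=> t A mA; rewrite /walk_iter/= /kdirac/= !diracE.
- by move=> t; rewrite expr0 mul1r integral_dirac//= diracT mul1e.
Qed.

Lemma coupledS T : coupled T -> coupled T.+1.
Proof.
move=> [d [X [P [Z [mZ cZ tZ lZ eZ]]]]].
pose pr := nth_pair n1.
have pr_lt j : ((pr j).1 < (pr j).2)%N := nth_pair_lt n1 j.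
pose sh j w := angvel e (Z w).1 (Z w).2 (pr j).1 (pr j).2.
(* The extra angle at parameter [w.2] integrates the angular velocity along the curve; it depends on
   the past [w.1] but not on the new angle. *)
pose h j (w : X * R) := primitive (fun r => sh j (w.1, r)) w.2.
have mZ1 := measurableT_comp measurable_fst mZ.
have mZ2 := measurableT_comp measurable_snd mZ.
have msh j : measurable_fun [set: X * R] (sh j) by exact: measurable_angvel.
have mh j : measurable_fun [set: X * R] (h j).
  exact: (measurable_primitive (msh j)).
pose Z' (w : ((X * R) * nat) * R) : M * M :=
  let o := w.1.1.1 in
  step e (pr w.1.2) (w.1.1.2 + h w.1.2 (o, w.2)) (Z (o, w.2)).
have mZ' : measurable_fun setT Z'.
  apply: (measurable_fun_natP (N := fun w => w.1.2)
    (F := fun j (w : ((X * R) * nat) * R) => let o := w.1.1.1 in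
      step e (pr j) (w.1.1.2 + h j (o, w.2)) (Z (o, w.2)))).
    exact: (measurableT_comp measurable_snd measurable_fst).
  move=> j.
  have m1 : measurable_fun setT (fun w : ((X * R) * nat) * R => (w.1.1.1, w.2)).
    apply: measurable_fun_pair => //.
    exact: (measurableT_comp measurable_fst
      (measurableT_comp measurable_fst measurable_fst)).
  have m2 : measurable_fun setT (fun w : ((X * R) * nat) * R =>
      w.1.1.2 + h j (w.1.1.1, w.2)).
    apply: measurable_funD; last exact: (measurableT_comp (mh j) m1).
    exact: (measurableT_comp measurable_snd
      (measurableT_comp measurable_fst measurable_fst)).
  have := measurable_step (pr j) e0 m2 (measurableT_comp mZ1 m1)
    (measurableT_comp mZ2 m1).
  by apply: eq_measurable_fun => w _ /=; rewrite -surjective_pairing.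
(* At a fixed [t] and a fixed past, the extra angle is a constant shift of the uniform angle and
   disappears from the mean. *)
have mean (F : M * M -> \bar R) t : measurable_fun setT F -> (forall z, 0 <= F z)%E ->
    (\int[noise_prob n P]_w F (Z' (w, t)) = \int[P]_o step_mean e F (Z (o, t)))%E.
  move=> mF F0; rewrite integral_noise//; last first.
    by apply: (measurableT_comp mF); exact: (measurableT_comp mZ' (pair2_measurable t)).
  apply: eq_integral => o _; congr (_ * _)%E; rewrite -(sum_nth_pair n1).
  apply: eq_bigr => j _; rewrite /Z'/=.
  apply: (@integral_uniform_shift _ (fun th => F (step e (pr j) th (Z (o, t)))) (h j (o, t))) => //.
    apply: (measurableT_comp mF); case: (Z (o, t)) => x v.
    exact: (measurable_step (pr j) e0 (@measurable_id _ R setT)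
       (measurable_cst x) (measurable_cst v)).
  by move=> th; rewrite step2pi.
exists _, _, (noise_prob n P), Z'; split => //.
- move=> [[x th] j].
  have il : (pr j).1 != (pr j).2 by rewrite -val_eqE/= ltn_eqF.
  have msho : measurable_fun [set: R] (fun r => sh j (x, r)).
    exact: (measurableT_comp (msh j) (pair1_measurable x)).
  have shB r : `|sh j (x, r)| <= (1 + 4 * B) / e.
    have [tz Bz] := tZ (x, r).
    apply: (le_trans (angvel_bound (pr j) e0 tz)).
    by rewrite ler_pM2r ?invr_gt0// lerD2l ler_pM2l// (le_trans Bz).
  have sh0 r : r \notin `[0, 1] -> sh j (x, r) = 0.
    move=> r01; have [_ V0 _ _] := cZ x.
    have nr : ~ regular s r by move=> /regular01; apply/negP.
    have := V0 _ nr; rewrite /sh => ->.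
    by rewrite /angvel /tang /rdot !big1 => [|i _|i _]; rewrite ?mxE ?mul0r// subr0 oppr0 mul0r.
  apply: (curve_step (h := fun t => h j (x, t)) _ il e0 (cZ x)).
    exact: (continuous_primitive msho shB sh0).
  move=> t rt; apply: (is_derive_primitive msho shB sh0).
  exact: (curve_angvel_continuous (i := (pr j).1) (l := (pr j).2) e0 (cZ x) rt).
- move=> w; have [tz Bz] := tZ (w.1.1.1, w.2); split.
    exact: tangent_step.
  by apply: le_trans Bz; exact: sqnorm_step_le.
- move=> t A mA.
  have mAF : measurable_fun setT (fun z : M * M => (\1_A z.1)%:E : \bar R).
    by apply/measurable_EFinP; apply: (measurableT_comp _ measurable_fst).
  have A0 (z : M * M) : (0 <= (\1_A z.1 : R)%:E)%E by rewrite lee_fin.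
  have := mean _ t mAF A0.
  set E := [set o | A (Z' (o, t)).1].
  have mE : measurable E.
    rewrite -[E]setTI.
    exact: (measurableT_comp measurable_fst
      (measurableT_comp mZ' (pair2_measurable t))).
  have -> : (\int[noise_prob n P]_w (\1_A (Z' (w, t)).1)%:E = noise_prob n P E)%E.
    rewrite -[E in RHS]setIT -(integral_indic (noise_prob n P) measurableT mE).
    apply: eq_integral => w _; congr (_%:E); rewrite !indicE.
  move=> ->; under eq_integral do rewrite step_mean_indic//.
  have mz : measurable_fun [set: X] (fun o => (Z (o, t)).1).
    exact: (measurableT_comp mZ1 (pair2_measurable t)).
  (* The law after one more step integrates [walk_kernel] against the law of the position, known by
     induction. *)
  transitivity (\int[pushforward P (fun o => (Z (o, t)).1)]_y walk_kernel y A)%E.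
    rewrite ge0_integral_pushforward//.
    exact: (measurable_kernel (@walk_kernel R n k) A mA).
  by apply: eq_measure_integral => D mD _; exact: lZ.
- move=> t.
  have mE : measurable_fun setT (fun z : M * M => (energy z)%:E).
    by apply/measurable_EFinP; exact: measurable_lyap.
  have E0 (z : M * M) : (0 <= (energy z)%:E)%E by rewrite lee_fin energy_ge0.
  have mzt : measurable_fun [set: X] (fun o => Z (o, t)).
    exact: (measurableT_comp mZ (pair2_measurable t)).
  have r0 := rate_ge0.
  rewrite (mean _ t mE E0).
  apply: (@le_trans _ _ (\int[P]_o ((rate R n k)%:E * (energy (Z (o, t)))%:E))%E).
    apply: ge0_le_integral => //.
    - move=> o _; rewrite /step_mean mule_ge0 ?lee_fin ?invr_ge0// sume_ge0// => p _.
      exact: integral_ge0.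
    - exact: (measurableT_comp (measurable_step_mean mE E0) mzt).
    - by apply: measurable_funeM; exact: (measurableT_comp mE mzt).
    - move=> o _; have [[XX XV] _] := tZ (o, t).
      by rewrite -EFinM; exact: step_mean_energy_le.
  rewrite ge0_integralZl//; last exact: (measurableT_comp mE mzt).
  by rewrite exprS -mulrA EFinM; apply: lee_wpmul2l.
Qed.

Lemma coupledT T : coupled T.
Proof. by elim: T => [|T]; [exact: coupled0|exact: coupledS]. Qed.

End coupled.

(** * Admissible curves *)

Section clamp.
Context (R : realType).

(** Retraction of the line onto a segment: composition with it extends functions continuous on the
    segment. *)
Definition clamp (a b t : R) : R := Num.max a (Num.min b t).

Lemma clamp_itv a b t : a <= b -> clamp a b t \in `[a, b].
Proof. by move=> ab; rewrite /clamp in_itv/= le_max lexx/= ge_max ab ge_min lexx. Qed.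

Lemma clamp_id a b t : t \in `[a, b] -> clamp a b t = t.
Proof. by rewrite in_itv/= => /andP[at_ tb]; rewrite /clamp min_r// max_r. Qed.

Lemma clamp_lipschitz a b t u : a <= b -> `|clamp a b t - clamp a b u| <= `|t - u|.
Proof.
move=> ab; rewrite ler_norml.
have := ler_norm (t - u); have := ler_norm (u - t); rewrite distrC.
rewrite /clamp; case: (leP b t) => bt; case: (leP b u) => bu;
  rewrite ?(max_r ab); (try case: (leP a t) => ?); (try case: (leP a u) => ?);
  move=> ? ?; apply/andP; split; lra.
Qed.

Lemma continuous_clamp a b : a <= b -> continuous (clamp a b).
Proof.
move=> ab t; apply/cvgrPdist_lt => e e0; near=> u.
apply: le_lt_trans (clamp_lipschitz _ _ ab) _.
by near: u; apply/nbhs_ballP; exists e.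
Unshelve. all: by end_near. Qed.

Lemma continuous_comp_clamp a b (f : R -> R) : a <= b ->
  {within `[a, b], continuous f} -> continuous (f \o clamp a b).
Proof.
move=> ab /subspace_continuousP cf t.
have ct := cf _ (clamp_itv t ab).
apply: cvg_trans ct; move=> A /= nA.
have H : \forall u \near t, clamp a b u \in `[a, b] -> A (f (clamp a b u)).
  exact: (continuous_clamp ab nA).
by apply: filterS H => u /(_ (clamp_itv u ab)).
Qed.

End clamp.

Section admissible.
Context (R : realType) (n k : nat).
Local Notation M := 'M[R]_(n, k).

Lemma continuous_mx (G : R -> M) :
  (forall i j, continuous (fun t => G t i j)) -> continuous G.
Proof.
move=> cG t; apply/cvg_ballP => e e0.
have H (ij : 'I_n * 'I_k) : \forall u \near t, ball (G t ij.1 ij.2) e (G u ij.1 ij.2).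
  by have /cvg_ballP := cG ij.1 ij.2 t; apply.
near=> u; suff Gu (ij : 'I_n * 'I_k) : ball (G t ij.1 ij.2) e (G u ij.1 ij.2).
  by split => // i j; exact: (Gu (i, j)).
by move: ij; near: u; exact: filter_forall.
Unshelve. all: by end_near. Qed.

Lemma within_entry (A : set R) (G : R -> M) i j :
  {within A, continuous G} -> {within A, continuous (fun t => G t i j)}.
Proof.
move=> /subspace_continuousP cG; apply/subspace_continuousP => t At.
apply: (@cvg_comp _ _ _ G (fun X : M => X i j) _ _ _ (cG t At)).
exact: coord_continuous.
Qed.

Lemma measurable_continuous_mx (G : R -> M) :
  (forall i j, continuous (fun t => G t i j)) -> measurable_fun [set: R] G.
Proof.
by move=> cG; apply: measurable_fun_mx => i j; exact: continuous_measurable_fun.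
Qed.

Lemma curve_piecewise_C1 s (G V : R -> M) : itv_partition 0 1 s ->
  curve s G V -> piecewise_C1 G.
Proof.
move=> s01 [cG _ dG cV]; split; first exact/continuous_subspaceT/continuous_mx.
exists s => // m ms.
have nE : nth 1 (0 :: s) m = nth 0 (0 :: s) m.
  by apply: set_nth_default; rewrite /= ltnW.
split=> [t tm|].
  apply/derivable_mxP => i j.
  by have /(_ i j) [] := dG t (ex_intro2 _ _ m ms tm).
have [W cW VW] := cV m ms; exists W.
  exact/continuous_subspaceT/continuous_mx.
move=> t tm; rewrite -VW// derive1E derive_mx.
  apply/matrixP => i j; rewrite mxE.
  by have /(_ i j) [] := dG t (ex_intro2 _ _ m ms tm).
apply/derivable_mxP => i j.
by have /(_ i j) [] := dG t (ex_intro2 _ _ m ms tm).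
Qed.

Lemma curve_derive1 s (G V : R -> M) t : curve s G V -> regular s t ->
  derive1 G t = V t.
Proof.
move=> [_ _ dG _] rt.
have dGt : derivable G t 1 by apply/derivable_mxP => i j; case: (dG t rt i j).
rewrite derive1E derive_mx//; apply/matrixP => i j; rewrite mxE.
by case: (dG t rt i j).
Qed.

(** Makes the exceptional set finite, hence negligible for lengths. The induction on [s] needs an
    arbitrary starting point in place of 0. *)
Lemma irregular_mem s t : itv_partition 0 1 s -> t \in `[0, 1] ->
  ~ regular s t -> t \in (0 :: s : seq R).
Proof.
rewrite in_itv/= => s01 /andP[t0 t1] nr; apply/negPn/negP => ts; apply: nr.
move: s01 ts t0; rewrite /itv_partition /regular /in_piece.
have : t <= last 0 s -> path <%R 0 s -> t \notin (0 :: s) -> 0 <= t ->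
    exists2 m, (m < size s)%N & t \in `]nth 1 (0 :: s) m, nth 1 (0 :: s) m.+1[.
  elim: s (0 : R) => [|a s IH] x /=.
    move=> tx _; rewrite inE => tnx xt.
    by move: tnx; rewrite eq_le tx xt.
  move=> tl /andP[xa pa]; rewrite inE negb_or => /andP[tx ts] xt.
  have [ta|at_] := ltP t a.
    by exists 0%N => //=; rewrite in_itv/= ta andbT lt_neqAle eq_sym tx.
  have [m ms tm] := IH a tl pa ts at_.
  by exists m.+1.
move=> H [ps /eqP ls] ts t0; apply: H => //.
by rewrite ls.
Qed.

End admissible.

(** * Position and velocity of a given piecewise C^1 curve on the manifold *)

Section initial.
Context (R : realType) (n k : nat).
Local Notation M := 'M[R]_(n, k).
Variables (g : R -> M) (s : seq R).
Hypothesis s01 : itv_partition 0 1 s.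
Hypothesis gst : {in `[0, 1], forall t, stiefel (g t)}.
Hypothesis cg : {within `[0, 1], continuous g}.
Hypothesis dg : forall m, (m < size s)%N ->
  let a := nth 1 (0 :: s) m in
  let b := nth 1 (0 :: s) m.+1 in
  {in `]a, b[, forall t, derivable g t 1} /\
  exists2 dgamma : R -> M, {within `[a, b], continuous dgamma} &
    {in `]a, b[, derive1 g =1 dgamma}.

Definition velocity t : M := if `[< regular s t >] then derive1 g t else 0.
Definition position t : M := g (clamp 0 1 t).

(** The continuous extension to the closed piece, composed with [clamp], is continuous on the line;
    the extreme value theorem bounds it on the piece. *)
Lemma piece_extension m : (m < size s)%N -> exists W : R -> M,
  [/\ forall i j, continuous (fun t => W t i j),
      forall t, in_piece s m t -> derive1 g t = W t &
      exists B, forall t, in_piece s m t -> sqnorm (W t) <= B].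
Proof.
move=> ms; have [_ [W cW gW]] := dg ms.
rewrite /in_piece; move: cW gW.
set a := nth _ _ m; set b := nth _ _ m.+1 => cW gW.
have [ab|ba] := leP a b; last first.
  exists (fun=> 0); split=> [i j|t|].
  - under eq_fun do rewrite mxE; by move=> t; exact: cvg_cst.
  - by rewrite in_itv/= => /andP[/lt_trans /[apply]]; rewrite ltNge (ltW ba).
  - exists 0 => t.
    by rewrite in_itv/= => /andP[/lt_trans /[apply]]; rewrite ltNge (ltW ba).
pose W' t := W (clamp a b t).
have cW' i j : continuous (fun t => W' t i j).
  have := continuous_comp_clamp ab (within_entry (i := i) (j := j) cW).
  exact: id.
exists W'; split=> // [t tm|].
  by rewrite gW// /W' clamp_id//; apply: subset_itv_oo_cc tm.
have cN : continuous (fun t => sqnorm (W' t)).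
  by apply: continuous_sumr => i; exact: continuous_rdot.
have [c _ cmax] := EVT_max ab (continuous_subspaceT (A := `[a, b]) cN).
exists (sqnorm (W' c)) => t tm; apply: cmax; exact: subset_itv_oo_cc tm.
Qed.

(** The pieces are glued one at a time, by induction on their number. *)
Lemma velocity_measurable_bounded : measurable_fun [set: R] velocity /\
  exists B, forall t, sqnorm (velocity t) <= B.
Proof.
have H : forall m, (m <= size s)%N -> exists F : R -> M,
  [/\ measurable_fun [set: R] F,
     forall t, (exists2 j, (j < m)%N & in_piece s j t) -> F t = derive1 g t,
     forall t, ~ (exists2 j, (j < m)%N & in_piece s j t) -> F t = 0 &
     exists B, forall t, sqnorm (F t) <= B].
  elim=> [_|m IH ms].
    exists (fun=> 0); split => //.
    - by move=> t [].
    - exists 0 => t; rewrite /sqnorm big1// => i _; rewrite sqnE big1// => j _.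
      by rewrite mxE expr0n.
  have [F [mF F1 F0 [B FB]]] := IH (ltnW ms).
  have [W [cW gW [B' WB]]] := piece_extension ms.
  exists (fun t => if in_piece s m t then W t else F t); split.
  - apply: measurable_fun_ifT => //; last exact: measurable_continuous_mx.
    apply: measurable_fun_bool => /=; rewrite setTI.
    rewrite (_ : _ @^-1` _ = `]nth 1 (0 :: s) m, nth 1 (0 :: s) m.+1[%classic)//.
  - move=> t [j jm tj]; case: ifPn => [/gW//|tm]; apply: F1; exists j => //.
    by rewrite ltn_neqAle -ltnS jm andbT; apply: contraNneq tm => <-.
  - move=> t nt; case: ifPn => tm; first by case: nt; exists m.
    by apply: F0 => -[j jm tj]; apply: nt; exists j => //; exact: ltnW.
  - exists (Num.max B B') => t; case: ifPn => tm; rewrite le_max.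
      by rewrite WB ?orbT.
    by rewrite FB.
have [F [mF F1 F0 FB]] := H _ (leqnn _).
have -> : velocity = F; last by [].
apply/funext => t; rewrite /velocity; case: asboolP => rt; first by rewrite F1.
by rewrite F0.
Qed.

Lemma position_id t : t \in `[0, 1] -> position t = g t.
Proof. by move=> t01; rewrite /position clamp_id. Qed.

Lemma position_curve : curve s position velocity.
Proof.
split.
- move=> i j; exact: (continuous_comp_clamp ler01 (within_entry (i := i) (j := j) cg)).
- by move=> t rt; rewrite /velocity asboolF.
- move=> t rt i j; rewrite /velocity asboolT//.
  have [m ms tm] := rt; have [dgt _] := dg ms.
  have dt : derivable g t 1 by exact: dgt.
  have near_eq : \forall u \near t, g u i j = position u i j.
    have : \forall u \near t, in_piece s m u by exact: near_in_itvoo.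
    apply: filterS => u um; rewrite position_id//.
    by apply: (regular01 s01); exists m.
  apply: (near_eq_is_derive near_eq).
  rewrite derive1E derive_mx// mxE; apply: derivableP.
  by move/derivable_mxP : dt.
- move=> m ms; have [W [cW gW _]] := piece_extension ms.
  exists W => // t tm; rewrite /velocity asboolT ?gW//; by exists m.
Qed.

Lemma position_tangent t : tangent (position t, velocity t).
Proof.
have st u : stiefel (position u) by apply: gst; exact: clamp_itv.
split => //=; rewrite /velocity; case: asboolP => rt; last first.
  by rewrite mulmx0 trmx0 mul0mx addr0.
have [_ _ dG _] := position_curve.
have dGt := dG t rt; rewrite /velocity asboolT// in dGt.
apply/matrixP => a b; rewrite [RHS]mxE mxE.
have E u : \sum_i position u i a * position u i b = (a == b)%:R.
  have := st u; rewrite /stiefel/= => /matrixP/(_ a b).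
  by rewrite !mxE => <-; apply: eq_bigr => i _; rewrite mxE.
(* The product rule differentiates entry (a, b) of X^T X, which is constant along the curve; the
   derivative is the matching entry of X^T V + V^T X. *)
have D : is_derive t 1 (\sum_i ((fun u => position u i a) * (fun u => position u i b)))
    (\sum_i (position t i a *: derive1 g t i b + position t i b *: derive1 g t i a)).
  by apply: is_derive_sum => i; apply: is_deriveM; exact: dGt.
have E' : \sum_i ((fun u => position u i a) * (fun u => position u i b)) =
    cst ((a == b)%:R : R).
  by apply/funext => u; rewrite fct_sumE; exact: E.
rewrite E' in D.
have [_ D0] := is_derive_cst ((a == b)%:R : R) t 1.
have [_ D1] := D; rewrite D0 in D1.
rewrite [RHS]D1 mxE [X in _ + X]mxE -big_split/=; apply: eq_bigr => i _.
by rewrite !mxE /GRing.scale/= [X in _ + X]mulrC.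
Qed.

End initial.

(** * Length and Wasserstein distance *)

Section exceptional.
Context (R : realType).
Local Notation mu := (@lebesgue_measure R).

Lemma measurable_fun_off_countable (D E : set R) (f g : R -> R) :
  measurable D -> countable E -> measurable_fun [set: R] g ->
  (forall t, D t -> ~ E t -> f t = g t) -> measurable_fun D f.
Proof.
move=> mD cE mg fg _ Y mY.
have mE A : countable A -> measurable (A : set R).
  by apply: countable_measurable => t; exact: measurable_set1.
have -> : D `&` f @^-1` Y = ((D `&` g @^-1` Y) `\` E) `|` (D `&` f @^-1` Y `&` E).
  apply/seteqP; split=> t /=.
    move=> [Dt Yt]; have [Et|Et] := pselect (E t); first by right.
    by left; split=> //; split=> //; rewrite -fg.
  by move=> [[[Dt Yt] Et]|[]//]; split=> //; rewrite fg.
apply: measurableU.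
  apply: measurableD; last exact: mE.
  by apply: measurableI => //; rewrite -[X in measurable X]setTI; exact: mg.
by apply: mE; apply: sub_countable cE; apply: subset_card_le => t [].
Qed.

Lemma integral_off_countable (D E : set R) (f g : R -> R) :
  measurable D -> countable E -> measurable_fun [set: R] g ->
  (forall t, 0 <= f t) -> (forall t, 0 <= g t) ->
  (forall t, D t -> ~ E t -> f t = g t) ->
  (\int[mu]_(t in D) (f t)%:E = \int[mu]_(t in D) (g t)%:E)%E.
Proof.
move=> mD cE mg f0 g0 fg; apply: ge0_ae_eq_integral => //.
- apply/measurable_EFinP; exact: (measurable_fun_off_countable mD cE mg fg).
- by apply/measurable_EFinP; exact: measurable_funS mg.
- by move=> t _; rewrite lee_fin.
- by move=> t _; rewrite lee_fin.
- exists E; split.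
  + by apply: countable_measurable cE => t; exact: measurable_set1.
  + exact: countable_lebesgue_measure0.
  + by move=> t /= H; apply: contrapT => Et; apply: H => Dt; rewrite fg.
Qed.

End exceptional.

Lemma measurable_sqrt (R : realType) d (X : measurableType d) (N : X -> R) :
  measurable_fun [set: X] N -> measurable_fun [set: X] (fun x => Num.sqrt (N x)).
Proof.
move=> mN; apply: (@measurableT_comp _ _ _ _ _ _ (@Num.sqrt R)) => //.
by apply: continuous_measurable_fun; exact: sqrt_continuous.
Qed.

Section length.
Context (R : realType) (n k : nat).
Local Notation M := 'M[R]_(n, k).

Lemma frobenius_normE (A : M) : frobenius_norm A = Num.sqrt (sqnorm A).
Proof.
by rewrite /frobenius_norm /sqnorm; congr (Num.sqrt _); apply: eq_bigr => i _; rewrite sqnE.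
Qed.

(** Replaces [derive1], arbitrary at the break points, by a measurable velocity, and the segment by
    the whole line, where Tonelli's theorem is applied. *)
Lemma curve_lengthE s (G V : R -> M) : itv_partition 0 1 s ->
  (forall t, regular s t -> derive1 G t = V t) -> (forall t, ~ regular s t -> V t = 0) ->
  measurable_fun [set: R] V ->
  (curve_length G = \int[lebesgue_measure]_t (Num.sqrt (sqnorm (V t)))%:E)%E.
Proof.
move=> s01 GV V0 mV.
transitivity (\int[lebesgue_measure]_(t in `[0%R, 1%R])
    (Num.sqrt (sqnorm (V t)))%:E)%E.
  apply: (@integral_off_countable _ _ [set` (0 :: s : seq R)]) => //.
  - by apply: finite_set_countable; exact: finite_seq.
  - by apply: measurable_sqrt; exact: measurable_sqnorm.
  - by move=> t; exact: sqrtr_ge0.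
  move=> t t01 tE; rewrite frobenius_normE GV//.
  by apply: contrapT => nr; apply: tE => /=; exact: irregular_mem nr.
rewrite integral_mkcond; apply: eq_integral => t _; rewrite patchE.
case: ifPn => //; rewrite notin_setE => t01; rewrite V0; last first.
  by move=> /(regular01 s01).
rewrite /sqnorm big1 ?sqrtr0// => i _; rewrite sqnE big1// => j _.
by rewrite mxE expr0n.
Qed.

End length.

(** * From random curves to the Wasserstein distance *)

Section contraction.
Context (R : realType) (n k : nat).
Local Notation M := 'M[R]_(n, k).

Import HBNNSimple.

(** The joint law of [x] and [y] is the coupling. The cost [f] is not assumed measurable, so its
    integral is compared with that of [F] through the simple functions below it. *)
Lemma wasserstein_le (f : M -> M -> \bar R) d (X : measurableType d)
    (P : probability X R) (x y : X -> M) (p q : set M -> \bar R) (F : X -> \bar R) :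
  measurable_fun [set: X] x -> measurable_fun [set: X] y ->
  (forall A, measurable A -> P (x @^-1` A) = p A) ->
  (forall A, measurable A -> P (y @^-1` A) = q A) ->
  (forall a b, 0 <= f a b)%E -> measurable_fun [set: X] F ->
  (forall o, f (x o) (y o) <= F o)%E ->
  (wasserstein f p q <= \int[P]_o F o)%E.
Proof.
move=> mx my px qy f0 mF fF.
have mxy : measurable_fun [set: X] (fun o => (x o, y o)) by exact: measurable_fun_pair.
pose xy : {mfun X >-> (M * M)%type} :=
  HB.pack (fun o => (x o, y o)) (isMeasurableFun.Build _ _ _ _ _ mxy).
have F0 o : (0 <= F o)%E by exact: le_trans (f0 _ _) (fF o).
apply: (@le_trans _ _ (\int[distribution P xy]_z f z.1 z.2)%E).
  apply: ereal_inf_lbound; exists (distribution P xy) => // A mA; split.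
    exact: px.
  exact: qy.
apply: integral_le_nnsfun => // g gf.
rewrite ge0_integral_distribution//; last 2 first.
  exact/measurable_EFinP.
  by move=> z; rewrite lee_fin.
apply: ge0_le_integral => //.
- by move=> o _; rewrite lee_fin.
- apply/measurable_EFinP; exact: (measurableT_comp _ mxy).
- by move=> o _; apply: le_trans (fF o); exact: gf.
Qed.

Lemma curve_length_ge0 (G : R -> M) : (0 <= curve_length G)%E.
Proof. by apply: integral_ge0 => t _; rewrite lee_fin sqrtr_ge0. Qed.

Lemma stiefel_dist_ge0 (X Y : M) : (0 <= stiefel_dist X Y)%E.
Proof. by apply: le_ereal_inf_tmp => _ [g _ <-]; exact: curve_length_ge0. Qed.

(* [2 c sqrt N <= N + c ^ 2] reduces the first moment to the second. *)
Lemma mean_sqrt_le d (X : measurableType d) (P : probability X R) (N : X -> R) (c : R) :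
  measurable_fun [set: X] N -> (forall o, 0 <= N o) -> 0 < c ->
  (\int[P]_o (N o)%:E <= (c ^+ 2)%:E)%E ->
  (\int[P]_o (Num.sqrt (N o))%:E <= c%:E)%E.
Proof.
move=> mN N0 c0 Nc.
apply: (@le_trans _ _ (\int[P]_o ((2 * c)^-1%:E * (N o)%:E + (c / 2)%:E))%E).
  apply: ge0_le_integral => //.
  - by apply/measurable_EFinP; exact: measurable_sqrt.
  - apply: emeasurable_funD => //; apply: measurable_funeM; exact/measurable_EFinP.
  - move=> o _; rewrite -EFinM -EFinD lee_fin.
    have := sqr_ge0 (Num.sqrt (N o) - c); have := sqr_sqrtr (N0 o).
    move: (Num.sqrt (N o)) => r <- h.
    rewrite -subr_ge0 [leRHS](_ : _ = (r - c) ^+ 2 / (2 * c)).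
      by rewrite divr_ge0// mulr_ge0// ltW.
    by field; rewrite gt_eqF.
have mE : measurable_fun [set: X] (EFin \o N) by exact/measurable_EFinP.
have c2 : (0 <= ((2 * c)^-1)%:E :> \bar R)%E by rewrite lee_fin invr_ge0 mulr_ge0// ltW.
rewrite ge0_integralD//; last 3 first.
- by move=> o _; rewrite mule_ge0// lee_fin.
- exact: measurable_funeM.
- by move=> o _; rewrite lee_fin divr_ge0// ltW.
rewrite ge0_integralZl//; last by move=> o _; rewrite lee_fin.
rewrite integral_cst//= probability_setT mule1.
apply: (@le_trans _ _ (((2 * c)^-1)%:E * (c ^+ 2)%:E + (c / 2)%:E)%E).
  by apply: leeD => //; exact: lee_wpmul2l.
rewrite -EFinM -EFinD lee_fin le_eqVlt; apply/orP; left; apply/eqP.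
by field; rewrite gt_eqF.
Qed.

End contraction.

Section contraction.
Context (R : realType) (n k : nat).
Local Notation M := 'M[R]_(n, k).
Hypotheses (k0 : (0 < k)%N) (kn : (k < n)%N).

(** The distance is at most the mean length, which is the integral of the mean speeds. For [c = 1]
    these are bounded because speeds never increase, otherwise because the mean energy decays. *)
Lemma wasserstein_curve_le (T : nat) (g : R -> M) (c : R) : 0 < c ->
  c = 1 \/ rate R n k ^+ T * n%:R <= c ^+ 2 ->
  piecewise_C1 g -> {in `[0, 1], forall t, stiefel (g t)} ->
  (wasserstein (@stiefel_dist R n k) (walk_iter T (g 0%R)) (walk_iter T (g 1%R))
   <= c%:E * curve_length g)%E.
Proof.
move=> c0 cT [cg [s s01 dg]] gst.
have [mV [B VB]] := velocity_measurable_bounded dg.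
have pc := position_curve s01 cg dg.
have pt := position_tangent s01 gst cg dg.
have pid t : t \in `[0, 1] -> position g t = g t by exact: position_id.
set V0 := velocity g s in mV VB pc pt.
set G0 := position g in pc pt pid.
pose Z0 t : M * M := (G0 t, V0 t).
have mG0 : measurable_fun [set: R] G0.
  by apply: measurable_continuous_mx; case: pc.
have mZ0 : measurable_fun [set: R] Z0 by exact: measurable_fun_pair.
have [d [X [P [Z [mZ cZ tZ lZ eZ]]]]] := coupledT k0 kn s01 mZ0 pc pt VB T.
have mZ1 := measurableT_comp measurable_fst mZ.
have mZ2 := measurableT_comp measurable_snd mZ.
have mZ1t t : measurable_fun [set: X] (fun o => (Z (o, t)).1).
  exact: (measurableT_comp mZ1 (pair2_measurable t)).
have mZ2t t : measurable_fun [set: X] (fun o => (Z (o, t)).2).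
  exact: (measurableT_comp mZ2 (pair2_measurable t)).
have mZ2o o : measurable_fun [set: R] (fun t => (Z (o, t)).2).
  exact: (measurableT_comp mZ2 (pair1_measurable o)).
pose f (w : X * R) := (Num.sqrt (sqnorm (Z w).2))%:E.
have mf : measurable_fun setT f.
  by apply/measurable_EFinP/measurable_sqrt; exact: measurable_sqnorm.
have f0 w : (0 <= f w)%E by rewrite lee_fin sqrtr_ge0.
have in0 : (0 : R) \in `[0, 1] by rewrite in_itv/= lexx ler01.
have in1 : (1 : R) \in `[0, 1] by rewrite in_itv/= lexx ler01.
have lengthE o : curve_length (fun t => (Z (o, t)).1) =
    (\int[lebesgue_measure]_t f (o, t))%E.
  rewrite (curve_lengthE s01 (V := fun t => (Z (o, t)).2))//.
  - by move=> t rt; exact: (curve_derive1 (cZ o) rt).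
  - by case: (cZ o).
apply: (@le_trans _ _ (\int[P]_o \int[lebesgue_measure]_t f (o, t))%E).
  apply: (@wasserstein_le _ _ _ _ _ _ _ (fun o => (Z (o, 0)).1) (fun o => (Z (o, 1)).1)) => //.
  - by move=> A mA; rewrite [LHS]lZ//= pid.
  - by move=> A mA; rewrite [LHS]lZ//= pid.
  - by move=> a b; exact: stiefel_dist_ge0.
  - exact: (@measurable_fun_fubini_tonelli_F _ _ _ _ _ lebesgue_measure f).
  - move=> o; rewrite -lengthE; apply: ereal_inf_lbound.
    exists (fun t => (Z (o, t)).1) => //; split => //.
      exact: curve_piecewise_C1 (cZ o).
    by move=> t _; have [[]] := tZ (o, t).
have -> : (\int[P]_o \int[lebesgue_measure]_t f (o, t) =
    \int[lebesgue_measure]_t \int[P]_o f (o, t))%E.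
  exact: (@fubini_tonelli _ _ _ _ _ P lebesgue_measure f).
have gV0 t : regular s t -> derive1 g t = V0 t by move=> rt; rewrite /V0 /velocity asboolT.
have V00 t : ~ regular s t -> V0 t = 0 by move=> rt; rewrite /V0 /velocity asboolF.
rewrite (curve_lengthE s01 gV0 V00 mV) -ge0_integralZl//; last 2 first.
- by apply/measurable_EFinP/measurable_sqrt; exact: measurable_sqnorm.
- by rewrite lee_fin ltW.
apply: ge0_le_integral => //.
- by move=> t _; exact: integral_ge0.
- exact: (@measurable_fun_fubini_tonelli_G _ _ _ _ _ P f).
- apply: measurable_funeM.
  by apply/measurable_EFinP/measurable_sqrt; exact: measurable_sqnorm.
move=> t _; rewrite -EFinM.
have NN o : sqnorm (Z (o, t)).2 <= sqnorm (V0 t) by have [_] := tZ (o, t).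
have le_sqrt : (\int[P]_o f (o, t) <= (Num.sqrt (sqnorm (V0 t)))%:E)%E.
  apply: (@le_trans _ _ (\int[P]_o (Num.sqrt (sqnorm (V0 t)))%:E)%E); last first.
    by rewrite integral_cst//= probability_setT mule1.
  apply: ge0_le_integral => //.
  - exact: (measurableT_comp mf (pair2_measurable t)).
  - by move=> o _; rewrite lee_fin ler_sqrt// sqnorm_ge0.
case: cT => [->|cT]; first by rewrite mul1r.
(* [mean_sqrt_le] asks for a positive bound; where the initial speed is 0, [le_sqrt] is enough. *)
have [N0|N0] := eqVneq (sqnorm (V0 t)) 0.
  by move: le_sqrt; rewrite N0 sqrtr0 mulr0.
have Np : 0 < sqnorm (V0 t) by rewrite lt_neqAle eq_sym N0 sqnorm_ge0.
apply: mean_sqrt_le.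
- exact: measurable_sqnorm.
- by move=> o; exact: sqnorm_ge0.
- by rewrite mulr_gt0// sqrtr_gt0.
apply: (@le_trans _ _ (\int[P]_o (energy (Z (o, t)))%:E)%E).
  apply: ge0_le_integral => //.
  - by move=> o _; rewrite lee_fin sqnorm_ge0.
  - by apply/measurable_EFinP; exact: measurable_sqnorm.
  - by apply/measurable_EFinP; exact: measurable_lyap.
  - by move=> o _; rewrite lee_fin; exact: sqnorm_le_lyap.
apply: (le_trans (eZ t)); rewrite lee_fin exprMn sqr_sqrtr ?sqnorm_ge0//.
have [XX _] := pt t.
have := lyap_le (V0 t) XX k0 kn; rewrite -[lyap _ _ _ _]/(energy (Z0 t)) => En.
have rT : 0 <= rate R n k ^+ T by rewrite exprn_ge0// rate_ge0.
apply: (le_trans (ler_wpM2l rT En)).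
by rewrite mulrA ler_wpM2r ?sqnorm_ge0.
Qed.

(** 792 = 3 * 264: the steps bring [rate ^+ T] below n^(-3 m). The energy bound costs one factor n,
    and m >= 1 leaves n^(-2 m), the square of the wanted factor. *)
Lemma rate_exp_le (T m : nat) : (0 < m)%N ->
  m%:R <= T%:R / (792 * n%:R * (k%:R + ln n%:R) * ln n%:R) :> R ->
  rate R n k ^+ T * n%:R <= (n%:R ^- m) ^+ 2 :> R.
Proof.
move=> m0 mT.
have n1 : (1 < n)%N by exact: leq_ltn_trans kn.
have n0 : 0 < n%:R :> R by rewrite ltr0n ltnW.
have k0' : 0 < k%:R :> R by rewrite ltr0n.
have L0 : 0 < ln n%:R :> R by rewrite ln_gt0// ltr1n.
set L := ln n%:R in mT L0.
have p792 : 0 < 792 :> R by rewrite ltr0n.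
have p264 : 0 < 264 * k%:R :> R by apply: (mulr_gt0 _ k0'); rewrite ltr0n.
have p528 : 0 < 528 * k%:R :> R by apply: (mulr_gt0 _ k0'); rewrite ltr0n.
have D0 : 0 < 792 * n%:R * (k%:R + L) * L.
  exact: mulr_gt0 (mulr_gt0 (mulr_gt0 p792 n0) (addr_gt0 k0' L0)) L0.
have TL : 3 * m%:R * L <= T%:R * (264 * k%:R * n%:R)^-1.
  rewrite ler_pdivlMr; last exact: mulr_gt0.
  move: mT; rewrite (ler_pdivlMr _ _ D0) => mT; apply: le_trans mT.
  have : 0 <= m%:R * (792 * n%:R * L * L).
    apply: (mulr_ge0 (ler0n _ _) (ltW _)); apply: (mulr_gt0 _ L0).
    exact: mulr_gt0 (mulr_gt0 p792 n0) L0.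
  nra.
(* From 1 - x <= exp(- x) and C(n, 2) <= n^2 / 2. *)
have rE : rate R n k <= expR (- (264 * k%:R * n%:R)^-1).
  apply: le_trans (expR_ge1Dx _); rewrite /rate lerD2l lerN2.
  have C2 : 'C(n, 2)%:R <= n%:R ^+ 2 / 2 :> R.
    rewrite ler_pdivlMr// -natrM -natrX ler_nat mulnC -mul_bin_diag bin1.
    by rewrite expnS expn1 leq_mul2l leq_pred orbT.
  have C0 : 0 < 'C(n, 2)%:R :> R by rewrite ltr0n bin_gt0.
  rewrite (ler_pdivlMr _ _ C0) ler_pdivrMl; last exact: mulr_gt0.
  rewrite mulrA (ler_pdivlMr _ _ p528).
  have : 0 <= 528 * k%:R * (n%:R ^+ 2 / 2 - 'C(n, 2)%:R) :> R.
    by apply: (mulr_ge0 (ltW p528)); rewrite subr_ge0.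
  nra.
have : rate R n k ^+ T <= expR (- (3 * m%:R * L)).
  apply: (@le_trans _ _ (expR (- (264 * k%:R * n%:R)^-1) ^+ T)).
    by rewrite lerXn2r ?nnegrE ?expR_ge0 ?rate_ge0.
  by rewrite -expRM_natl ler_expR mulrN lerN2.
move=> rT; apply: (@le_trans _ _ (expR (- (3 * m%:R * L)) * n%:R)).
  by rewrite ler_pM2r.
have nE : n%:R = expR L by rewrite lnK.
rewrite [in leLHS]nE -expRD nE -expRM_natl -expRN -expRM_natl ler_expR.
have m1 : 1 <= m%:R :> R by rewrite ler1n.
nra.
Qed.

End contraction.

Theorem theorem2p6 (R : realType) :
  exists2 C : R, 0 < C &
    forall n k : nat, (1 <= k)%N -> (k < n)%N ->
    forall (T : nat) (X0 Y0 : 'M[R]_(n, k)), stiefel X0 -> stiefel Y0 ->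
      (wasserstein (@stiefel_dist R n k) (walk_iter T X0) (walk_iter T Y0) <=
        (n%:R ^ (- Num.floor (T%:R / (C * n%:R * (k%:R + ln n%:R) * ln n%:R))))%:E
          * stiefel_dist X0 Y0)%E.
Proof.
have p792 : 0 < 792 :> R by rewrite ltr0n.
exists 792; first exact: p792.
move=> n k k0 kn T X0 Y0 _ _.
have n0 : 0 < n%:R :> R by rewrite ltr0n (leq_ltn_trans _ kn).
have L0 : 0 <= ln n%:R :> R by rewrite ln_ge0// ler1n -(ltr0n R).
set x := T%:R / _.
have x0 : 0 <= x.
  apply: (divr_ge0 (ler0n _ _) _); apply: (mulr_ge0 _ L0).
  exact: mulr_ge0 (ltW (mulr_gt0 p792 n0)) (addr_ge0 (ler0n _ _) L0).
have [m mE] : exists m : nat, Num.floor x = m%:Z.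
  by have := x0; rewrite -floor_ge0; case: Num.floor => // m _; exists m.
have mx : m%:R <= x by have := floor_le_tmp x; rewrite mE.
rewrite mE -exprnN.
have c0 : 0 < n%:R ^- m :> R by rewrite invr_gt0 exprn_gt0.
(* For [m = 0] the factor n lost in the energy bound could not be recovered, and the factor 1 comes
   from the monotone speeds. *)
have cT : n%:R ^- m = 1 :> R \/ rate R n k ^+ T * n%:R <= (n%:R ^- m) ^+ 2 :> R.
  by case: m {mE c0} mx => [|m] mx; [left; rewrite expr0 invr1|right; exact: rate_exp_le].
(* Moving the factor to the left exposes the infimum of lengths, so that a bound for each admissible
   curve suffices. *)
rewrite -lee_pdivrMl//; apply: le_ereal_inf_tmp => _ [g [gC g0 g1 gst] <-].
by rewrite lee_pdivrMl// -g0 -g1; exact: wasserstein_curve_le.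
Qed.
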